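(* Let $\rho$ be any $n$-qubit quantum state and $\psi=|\psi\rangle\langle\psi|$ a pure state on at most 3 qubits. Let $k,m$ be positive integers, $p\in(0,1]$, $\varepsilon\in[0,1)$. Suppose there is a probabilistic stabilizer operation $\mathcal O$ with $\mathcal O(\rho^{\otimes k})=p\tau$, where $\tau$ is a state with $\langle\psi^{\otimes m}|\tau|\psi^{\otimes m}\rangle\ge1-\varepsilon$. Then $$k\ \ge\ \frac{\log p+\log(1-\varepsilon)+m\log F(\psi)^{-1}}{\log\Lambda^+(\rho)}\qquad\text{and}\qquad k\ \ge\ p\left(\frac{\log(1-\varepsilon)+m\log F(\psi)^{-1}}{\log\Lambda^+(\rho)}\right).$$
   Context: $\mathrm{S}_n$ denotes the set of pure $n$-qubit stabilizer states and $\bar{\mathrm S}_n=\mathrm{conv}\{|\phi\rangle\langle\phi|:|\phi\rangle\in\mathrm S_n\}$ the mixed stabilizer states. A probabilistic stabilizer operation is a completely positive, not necessarily trace-preserving (trace non-increasing) map $\mathcal O$ that is stabilizer preserving in the sense that $\mathcal O(\sigma)$ is proportional to an element of $\bar{\mathrm S}$ for every $\sigma\in\bar{\mathrm S}$ (forming one branch of a trace-preserving collection of such maps). The generalized robustness is $\Lambda^+(\rho)=\min\{\lambda:\rho\le\lambda\sigma,\ \sigma\in\bar{\mathrm S}_n\}$. The stabilizer fidelity of a pure state is $F(\psi)=\max_{|\phi\rangle\in\mathrm S}|\langle\psi|\phi\rangle|^2$, the maximum over pure stabilizer states on the same number of qubits as $\psi$. *)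

(* Defs.v *)
From HB Require Import structures.
From mathcomp Require Import all_boot all_order all_algebra.
From mathcomp Require Import all_classical all_reals.
From mathcomp Require Import exp.
From mathcomp Require Import complex mxtens.

Set Implicit Arguments.
Unset Strict Implicit.
Unset Printing Implicit Defensive.

Import Order.TTheory GRing.Theory Num.Theory.
Local Open Scope ring_scope.
Local Open Scope complex_scope.

Section Quantum.
Variable R : realType.
Local Notation C := R[i].

Definition adj {r c : nat} (A : 'M[C]_(r, c)) : 'M[C]_(c, r) := map_mx conjc A^T.

Definition psd {N : nat} (A : 'M[C]_N) : Prop :=
  forall x : 'cV[C]_N, 0 <= (adj x *m A *m x) 0 0.

Definition loewner_le {N : nat} (A B : 'M[C]_N) : Prop := psd (B - A).

Definition is_state {N : nat} (rho : 'M[C]_N) : Prop := psd rho /\ \tr rho = 1.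

Definition unit_vec {N : nat} (v : 'cV[C]_N) : Prop := (adj v *m v) 0 0 = 1.
Definition proj {N : nat} (v : 'cV[C]_N) : 'M[C]_N := v *m adj v.

Definition expect {N : nat} (v : 'cV[C]_N) (A : 'M[C]_N) : C := (adj v *m A *m v) 0 0.

Definition pauli1 (a : 'I_4) : 'M[C]_2 :=
  match val a with
  | 0 => 1
  | 1 => \matrix_(i < 2, j < 2) (if i != j then 1 else 0)
  | 2 => \matrix_(i < 2, j < 2)
           (if i == j then 0 else if val i == 0%N then - 'i else 'i)
  | _ => \matrix_(i < 2, j < 2)
           (if i == j then (if val i == 0%N then 1 else -1) else 0)
  end.

Fixpoint pauli_seq (s : seq 'I_4) : 'M[C]_(2 ^ size s) :=
  match s return 'M[C]_(2 ^ size s) with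
  | [::] => 1
  | a :: s' => castmx (esym (expnS 2 (size s')), esym (expnS 2 (size s')))
                      (pauli1 a *t pauli_seq s')
  end.

(* Pauli operator i^e * P_1 (x) ... (x) P_n, encoded as (e, (P_1,...,P_n)) *)
Definition pauli_op (n : nat) : Type := ('I_4 * n.-tuple 'I_4)%type.

Definition pauli_mx {n : nat} (P : pauli_op n) : 'M[C]_(2 ^ n) :=
  'i ^+ val P.1 *:
    castmx (congr1 (expn 2) (size_tuple P.2), congr1 (expn 2) (size_tuple P.2))
           (pauli_seq P.2).

Definition stab_vec {n : nat} (phi : 'cV[C]_(2 ^ n)) : Prop :=
  unit_vec phi /\
  #|[set P : pauli_op n | pauli_mx P *m phi == phi]| = (2 ^ n)%N.

Definition mixed_stab {n : nat} (sigma : 'M[C]_(2 ^ n)) : Prop :=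
  exists s : seq (R * 'cV[C]_(2 ^ n)),
    (forall x, x \in s -> 0 <= x.1 /\ stab_vec x.2) /\
    \sum_(x <- s) x.1 = 1 /\
    sigma = \sum_(x <- s) (x.1)%:C *: proj x.2.

Definition gen_rob {n : nat} (rho : 'M[C]_(2 ^ n)) : R :=
  inf [set l : R | exists sigma : 'M[C]_(2 ^ n),
                     mixed_stab sigma /\ loewner_le rho (l%:C *: sigma)].

Definition stab_fid {n : nat} (psi : 'cV[C]_(2 ^ n)) : R :=
  sup [set f : R | exists phi : 'cV[C]_(2 ^ n),
                     stab_vec phi /\ f = complex.Re ((adj psi *m phi) 0 0) ^+ 2 + complex.Im ((adj psi *m phi) 0 0) ^+ 2].

Definition qtpow {n : nat} (A : 'M[C]_(2 ^ n)) (k : nat) : 'M[C]_(2 ^ (n * k)) :=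
  castmx (esym (expnM 2 n k), esym (expnM 2 n k)) (A ^t k).

Definition vtpow {n : nat} (v : 'cV[C]_(2 ^ n)) (k : nat) : 'cV[C]_(2 ^ (n * k)) :=
  castmx (esym (expnM 2 n k), exp1n k) (v ^t k).

Section Ops.
Variables a b : nat.
Local Notation Min := ('M[C]_(2 ^ a)).
Local Notation Mout := ('M[C]_(2 ^ b)).

Definition blk (d : nat) (X : 'M[C]_(d * 2 ^ a)) (r c : 'I_d) : Min :=
  \matrix_(i, j) X (mxtens_index (r, i)) (mxtens_index (c, j)).

Definition id_tens (d : nat) (O : Min -> Mout) (X : 'M[C]_(d * 2 ^ a))
  : 'M[C]_(d * 2 ^ b) :=
  \sum_(r < d) \sum_(c < d) (delta_mx r c *t O (blk X r c)).

Definition linear_map (O : Min -> Mout) : Prop :=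
  forall (c : C) (X Y : Min), O (c *: X + Y) = c *: O X + O Y.

Definition completely_positive (O : Min -> Mout) : Prop :=
  forall (d : nat) (X : 'M[C]_(d * 2 ^ a)), psd X -> psd (id_tens O X).

Definition trace_nonincreasing (O : Min -> Mout) : Prop :=
  forall X : Min, psd X -> \tr (O X) <= \tr X.

Definition stab_preserving (O : Min -> Mout) : Prop :=
  forall sigma : Min, mixed_stab sigma ->
    exists (c : C) (sigma' : Mout), mixed_stab sigma' /\ O sigma = c *: sigma'.

Definition stab_branch (O : Min -> Mout) : Prop :=
  [/\ linear_map O, completely_positive O, trace_nonincreasing O
    & stab_preserving O].

Definition prob_stab_op (O : Min -> Mout) : Prop :=
  stab_branch O /\
  exists Os : seq (Min -> Mout),
    (forall O', O' \in Os -> stab_branch O') /\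
    (forall X : Min, \tr (O X + \sum_(O' <- Os) O' X) = \tr X).
End Ops.

End Quantum.

(* Main.v *)
Require Import Defs.
From HB Require Import structures.
From mathcomp Require Import all_boot all_order all_algebra.
From mathcomp Require Import all_classical all_reals.
From mathcomp Require Import exp.
From mathcomp Require Import complex mxtens.
From mathcomp Require Import sequences spectral ring lra.
Import Order.TTheory GRing.Theory Num.Theory.
Local Open Scope ring_scope.
Local Open Scope complex_scope.

(* The heart of the matter is the bound |<psi^m|phi>|^2 <= F(psi)^m for all stabilizer
   states phi. For an n-qubit stabilizer group S with code projector P_S, call psi aligned
   with constant F if <psi|P_S|psi> <= sqrt(2^n / |S|) F for all S. On at most three qubits
   every psi is aligned with constant F(psi): measuring successively well chosen logical
   Pauli operators leads from the code space to a stabilizer state while keeping a fraction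
   at least sqrt(|S| / 2^n) of the weight. Alignment constants are multiplicative: for S on
   AB let Z be the subgroup of the elements whose restrictions to B commute with those of
   all of S; positivity of a Gram matrix gives
   <P_S> <= sqrt(|Z| / |S|) <P_Z>, and P_Z is diagonal for the characters of Z on A.

   If rho <= l sigma, then rho^k <= l^k sigma^k; applying O, which succeeds with probability c
   on sigma^k, gives p (1 - eps) <= l^k c F^m, and the failure branches give
   1 - p <= l^k (1 - c). The first bound follows at once, the second by convexity of exp. *)

Set Implicit Arguments.
Unset Strict Implicit.
Unset Printing Implicit Defensive.

(** * Tensor products of matrices and phase-free Pauli labels *)

(** A stabilizer state on a tensor product is in general entangled, so its overlap with a product
    vector does not factor and no induction over stabilizer states alone can succeed. Cutting a
    stabilizer group along the factors produces smaller groups, that is, codes of higher dimension;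
    alignment therefore quantifies over all groups, and stabilizer states are the case |S| = 2^n.
    The square root is the normalization that closes the induction: sqrt(2^n |S|) multiplies both in
    the number of qubits and in the order, when a group splits into its restriction to A and the
    kernel of that restriction. All of this is phrased with Pauli expectations: <P_S> is the average
    of the signed expectations over S, and expectations of a product vector factor. A group is
    carried as a set of phase-free labels together with a sign function, so that subgroups, images
    and twists by characters live in an elementary abelian 2-group and the phases are confined to
    the cocycle [om]. *)

Lemma castmx_irr (T : Type) (m n m' n' : nat) (e1 f1 : m = m') (e2 f2 : n = n')
    (A : 'M[T]_(m, n)) : castmx (e1, e2) A = castmx (f1, f2) A.
Proof. by congr castmx; congr pair; apply: eq_irrelevance. Qed.

Lemma castmxD (V : nmodType) (m n m' n' : nat) (e : (m = m') * (n = n')) (A B : 'M[V]_(m, n)) :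
  castmx e (A + B) = castmx e A + castmx e B.
Proof. by case: e => e1 e2; case: m' / e1; case: n' / e2. Qed.

Section CastTens.
Variable K : comPzRingType.

Lemma castmxM (m n : nat) (e : m = n) (A B : 'M[K]_m) :
  castmx (e, e) (A *m B) = castmx (e, e) A *m castmx (e, e) B.
Proof. by case: n / e. Qed.

Lemma castmxZ (m n m' n' : nat) (e : (m = m') * (n = n')) a (A : 'M[K]_(m, n)) :
  castmx e (a *: A) = a *: castmx e A.
Proof. by case: e => e1 e2; case: m' / e1; case: n' / e2. Qed.

Lemma castmx1 (m n : nat) (e : m = n) : castmx (e, e) 1%:M = 1%:M :> 'M[K]_n.
Proof. by case: n / e. Qed.

Lemma mxtrace_castmx (m n : nat) (e : m = n) (A : 'M[K]_m) :
  \tr (castmx (e, e) A) = \tr A.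
Proof. by case: n / e. Qed.

Lemma tens_castl (m n p q m' n' : nat) (e1 : m = m') (e2 : n = n')
    (e1' : (m * p = m' * p)%N) (e2' : (n * q = n' * q)%N)
    (A : 'M[K]_(m, n)) (B : 'M[K]_(p, q)) :
  castmx (e1, e2) A *t B = castmx (e1', e2') (A *t B).
Proof.
by move: e1' e2'; case: m' / e1; case: n' / e2 => e1' e2'; rewrite !castmx_id.
Qed.

Lemma tens_castr (m n p q p' q' : nat) (e1 : p = p') (e2 : q = q')
    (e1' : (m * p = m * p')%N) (e2' : (n * q = n * q')%N)
    (A : 'M[K]_(m, n)) (B : 'M[K]_(p, q)) :
  A *t castmx (e1, e2) B = castmx (e1', e2') (A *t B).
Proof.
by move: e1' e2'; case: p' / e1; case: q' / e2 => e1' e2'; rewrite !castmx_id.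
Qed.

Lemma mxtens_indexA (m n p : nat) (i : 'I_m) (j : 'I_n) (k : 'I_p) :
  cast_ord (mulnA m n p) (mxtens_index (i, mxtens_index (j, k)))
  = mxtens_index (mxtens_index (i, j), k).
Proof. by apply: val_inj; rewrite /= mulnDl mulnA addnA. Qed.

Lemma tensmxA (m n p m' n' p' : nat) (A : 'M[K]_(m, m')) (B : 'M[K]_(n, n'))
    (D : 'M[K]_(p, p')) :
  castmx (mulnA m n p, mulnA m' n' p') (A *t (B *t D)) = (A *t B) *t D.
Proof.
apply/matrixP => i j.
case: (mxtens_indexP i) => i1 i3; case: (mxtens_indexP i1) => {}i1 i2.
case: (mxtens_indexP j) => j1 j3; case: (mxtens_indexP j1) => {}j1 j2.
by rewrite !tensmxE -!mxtens_indexA castmxE !cast_ordK !tensmxE mulrA.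
Qed.

Lemma tens1mx1 (m n : nat) : (1%:M : 'M[K]_m) *t (1%:M : 'M[K]_n) = 1%:M.
Proof.
apply/matrixP => i j; case: (mxtens_indexP i) => i1 i2.
case: (mxtens_indexP j) => j1 j2; rewrite tensmxE !mxE.
by rewrite (can_eq (@mxtens_indexK m n)) xpair_eqE -natrM mulnb.
Qed.

Lemma big_mxtens (T : nmodType) (m n : nat) (F : 'I_(m * n) -> T) :
  \sum_i F i = \sum_i \sum_j F (mxtens_index (i, j)).
Proof.
rewrite pair_big; apply: (reindex (fun x => mxtens_index (x.1, x.2))).
exists (@mxtens_unindex m n) => x _; last by rewrite -surjective_pairing mxtens_unindexK.
by rewrite mxtens_indexK -surjective_pairing.
Qed.

Lemma mxtrace_tens (m n : nat) (A : 'M[K]_m) (B : 'M[K]_n) :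
  \tr (A *t B) = \tr A * \tr B.
Proof.
rewrite /mxtrace big_mxtens mulr_suml; apply: eq_bigr => i _.
by rewrite mulr_sumr; apply: eq_bigr => j _; rewrite tensmxE.
Qed.

Lemma tensmxZ (m n p q : nat) a b (A : 'M[K]_(m, n)) (B : 'M[K]_(p, q)) :
  (a *: A) *t (b *: B) = (a * b) *: (A *t B).
Proof. by apply/matrixP => i j; rewrite !mxE mulrACA. Qed.

End CastTens.

(** * Labels of Pauli operators up to phase *)

Lemma I4_ind (P : 'I_4 -> Prop) :
  P (@Ordinal 4 0 isT) -> P (@Ordinal 4 1 isT) -> P (@Ordinal 4 2 isT) ->
  P (@Ordinal 4 3 isT) -> forall a, P a.
Proof.
move=> P0 P1 P2 P3 [[|[|[|[|//]]]] h].
- by rewrite (bool_irrelevance h isT).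
- by rewrite (bool_irrelevance h isT).
- by rewrite (bool_irrelevance h isT).
- by rewrite (bool_irrelevance h isT).
Qed.

(** The Klein four-group on I, X, Y, Z, in this order: the product of Pauli matrices with its phase
    forgotten. *)
Definition xor1 (a b : 'I_4) : 'I_4 :=
  match val a, val b with
  | 0, _ => b
  | _, 0 => a
  | 1, 1 | 2, 2 | 3, 3 => @Ordinal 4 0 isT
  | 1, 2 | 2, 1 => @Ordinal 4 3 isT
  | 1, 3 | 3, 1 => @Ordinal 4 2 isT
  | _, _ => @Ordinal 4 1 isT
  end.

Lemma xor1C : commutative xor1.
Proof. by do 2!elim/I4_ind. Qed.
Lemma xor1A : associative xor1.
Proof. by do 3!elim/I4_ind. Qed.
Lemma xor01 : left_id (@Ordinal 4 0 isT) xor1.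
Proof. by elim/I4_ind. Qed.
Lemma xor1N : left_inverse (@Ordinal 4 0 isT) id xor1.
Proof. by elim/I4_ind. Qed.

(* Pauli operators up to phase, as an elementary abelian 2-group. *)
Definition lab (n : nat) := n.-tuple 'I_4.
HB.instance Definition _ n := Finite.on (lab n).

Section LabGroup.
Variable n : nat.
Definition lab_add (t u : lab n) : lab n :=
  [tuple of [seq xor1 x.1 x.2 | x <- zip t u]].
Definition lab0 : lab n := [tuple of nseq n (@Ordinal 4 0 isT)].

Lemma tnth_lab_add t u i : tnth (lab_add t u) i = xor1 (tnth t i) (tnth u i).
Proof.
rewrite tnth_map (tnth_nth (xor1 (tnth t i) (tnth u i), tnth u i)) /= nth_zip ?size_tuple //.
by rewrite -!tnth_nth.
Qed.

Lemma lab_addA : associative lab_add.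
Proof. by move=> t u v; apply: eq_from_tnth => i; rewrite !tnth_lab_add xor1A. Qed.
Lemma lab_addC : commutative lab_add.
Proof. by move=> t u; apply: eq_from_tnth => i; rewrite !tnth_lab_add xor1C. Qed.
Lemma lab_add0 : left_id lab0 lab_add.
Proof. by move=> t; apply: eq_from_tnth => i; rewrite tnth_lab_add tnth_nseq xor01. Qed.
Lemma lab_addN : left_inverse lab0 id lab_add.
Proof. by move=> t; apply: eq_from_tnth => i; rewrite tnth_lab_add tnth_nseq xor1N. Qed.
HB.instance Definition _ :=
  GRing.isZmodule.Build (lab n) lab_addA lab_addC lab_add0 lab_addN.
End LabGroup.

Section LabTheory.
Variable n : nat.
Implicit Types t u v : lab n.

Lemma tnth_labD t u i : tnth (t + u) i = xor1 (tnth t i) (tnth u i).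
Proof. exact: tnth_lab_add. Qed.
Lemma labDD t : t + t = 0.
Proof. exact: (lab_addN t). Qed.
Lemma labN t : - t = t.
Proof. by []. Qed.
Lemma labKD t : cancel (+%R t) (+%R t).
Proof. by move=> u; rewrite addrA labDD add0r. Qed.
End LabTheory.

Definition lcons n (a : 'I_4) (t : lab n) : lab n.+1 := [tuple of a :: t].

Lemma lconsD n a b (t u : lab n) : lcons a t + lcons b u = lcons (xor1 a b) (t + u).
Proof. exact: val_inj. Qed.

Lemma lcons0 n : lcons (@Ordinal 4 0 isT) (0 : lab n) = 0.
Proof. exact: val_inj. Qed.

Variant lab_spec n : lab n.+1 -> Type := LabCons a (t : lab n) : lab_spec (lcons a t).

Lemma labP n (t : lab n.+1) : lab_spec t.
Proof. by case/tupleP: t => a t; exact: LabCons. Qed.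

Lemma lcons_eq n a b (t u : lab n) : (lcons a t == lcons b u) = (a == b) && (t == u).
Proof. by []. Qed.

Lemma lab_eq0 (t : lab 0) : t = 0.
Proof. by rewrite [t]tuple0 [0]tuple0. Qed.

Lemma big_lab0 (T : nmodType) (F : lab 0 -> T) : \sum_t F t = F 0.
Proof.
by rewrite (big_pred1 (0 : lab 0)) // => t; rewrite [t]lab_eq0 /= eqxx.
Qed.

Lemma big_lcons (T : nmodType) n (F : lab n.+1 -> T) :
  \sum_t F t = \sum_a \sum_t F (lcons a t).
Proof.
rewrite pair_big; apply: (reindex (fun x : 'I_4 * lab n => lcons x.1 x.2)).
exists (fun t : lab n.+1 => (thead t, [tuple of behead t])).
  by case=> a t _ /=; congr (_, _); apply: val_inj.
by move=> t _; case: (labP t) => a {}t /=; apply: val_inj.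
Qed.

Section Cat.
Variables a b : nat.
Definition lcat (t : lab a) (u : lab b) : lab (a + b) := [tuple of t ++ u].
Definition lfst (t : lab (a + b)) : lab a := [tuple of [seq tnth t (lshift b i) | i <- ord_tuple a]].
Definition lsnd (t : lab (a + b)) : lab b := [tuple of [seq tnth t (rshift a i) | i <- ord_tuple b]].

Lemma tnth_lfst t i : tnth (lfst t) i = tnth t (lshift b i).
Proof. by rewrite tnth_map tnth_ord_tuple. Qed.
Lemma tnth_lsnd t i : tnth (lsnd t) i = tnth t (rshift a i).
Proof. by rewrite tnth_map tnth_ord_tuple. Qed.

Lemma lfstD t u : lfst (t + u) = lfst t + lfst u.
Proof.
by apply: eq_from_tnth => i; rewrite tnth_lfst !tnth_labD !tnth_lfst.
Qed.
Lemma lsndD t u : lsnd (t + u) = lsnd t + lsnd u.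
Proof.
by apply: eq_from_tnth => i; rewrite tnth_lsnd !tnth_labD !tnth_lsnd.
Qed.
Lemma lcatK t u : lfst (lcat t u) = t /\ lsnd (lcat t u) = u.
Proof.
by split; apply: eq_from_tnth => i; rewrite (tnth_lfst, tnth_lsnd) (tnth_lshift, tnth_rshift).
Qed.
Lemma lfst_snd t : lcat (lfst t) (lsnd t) = t.
Proof.
apply: eq_from_tnth => i; rewrite -(splitK i); case: (fintype.split i) => j /=.
  by rewrite tnth_lshift tnth_lfst.
by rewrite tnth_rshift tnth_lsnd.
Qed.
End Cat.

(** * Pauli matrices *)

Lemma I2_ind (P : 'I_2 -> Prop) :
  P (@Ordinal 2 0 isT) -> P (@Ordinal 2 1 isT) -> forall a, P a.
Proof.
move=> P0 P1 [[|[|//]] h].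
- by rewrite (bool_irrelevance h isT).
- by rewrite (bool_irrelevance h isT).
Qed.

Section Pauli.
Variable R : realType.
Local Notation C := R[i].

Lemma adjE (r c : nat) (A : 'M[C]_(r, c)) i j : adj A i j = conjc (A j i).
Proof. by rewrite !mxE. Qed.

Lemma adjK (r c : nat) (A : 'M[C]_(r, c)) : adj (adj A) = A.
Proof. by apply/matrixP => i j; rewrite !adjE conjcK. Qed.

Lemma adjM (r c d : nat) (A : 'M[C]_(r, c)) (B : 'M[C]_(c, d)) :
  adj (A *m B) = adj B *m adj A.
Proof. by rewrite /adj trmx_mul map_mxM. Qed.

Lemma adjD (r c : nat) (A B : 'M[C]_(r, c)) : adj (A + B) = adj A + adj B.
Proof. by apply/matrixP => i j; rewrite !mxE rmorphD. Qed.

Lemma adjZ (r c : nat) a (A : 'M[C]_(r, c)) : adj (a *: A) = conjc a *: adj A.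
Proof. by apply/matrixP => i j; rewrite !mxE rmorphM. Qed.

Lemma adj_sum (I : Type) (s : seq I) (P : pred I) (r c : nat) (F : I -> 'M[C]_(r, c)) :
  adj (\sum_(i <- s | P i) F i) = \sum_(i <- s | P i) adj (F i).
Proof.
elim/big_rec2: _ => [|i x y _ <-]; last by rewrite adjD.
by apply/matrixP => i j; rewrite !mxE rmorph0.
Qed.

Lemma adj1 (n : nat) : adj (1%:M : 'M[C]_n) = 1%:M.
Proof. by rewrite /adj trmx1 map_mx1. Qed.

Lemma adj_tens (m n p q : nat) (A : 'M[C]_(m, n)) (B : 'M[C]_(p, q)) :
  adj (A *t B) = adj A *t adj B.
Proof. by rewrite /adj trmx_tens map_mxT. Qed.

Lemma adj_castmx (m n m' n' : nat) (e1 : m = m') (e2 : n = n') (A : 'M[C]_(m, n)) :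
  adj (castmx (e1, e2) A) = castmx (e2, e1) (adj A).
Proof. by case: m' / e1; case: n' / e2. Qed.

(* [P_a P_b = om1 a b P_(a+b)] for single-qubit Pauli matrices *)
Definition om1 (a b : 'I_4) : C :=
  match val a, val b with
  | 1, 2 | 2, 3 | 3, 1 => 'i
  | 2, 1 | 3, 2 | 1, 3 => - 'i
  | _, _ => 1
  end.

(** The commutation sign: -1 exactly for two different nontrivial Pauli matrices. *)
Definition sg1 (a b : 'I_4) : R :=
  if (a == @Ordinal 4 0 isT) || (b == @Ordinal 4 0 isT) || (a == b) then 1 else -1.

Lemma complex_eq (x y : C) : complex.Re x = complex.Re y -> complex.Im x = complex.Im y -> x = y.
Proof. by case: x y => [a b] [c d] /= -> ->. Qed.

Lemma pauli1_adj a : adj (pauli1 R a) = pauli1 R a.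
Proof.
apply/matrixP => i j; rewrite adjE.
by elim/I4_ind: a; rewrite /pauli1 /= !mxE; elim/I2_ind: i; elim/I2_ind: j;
   apply: complex_eq => /=; rewrite ?oppr0 ?opprK.
Qed.

Lemma pauli1M a b : pauli1 R a *m pauli1 R b = om1 a b *: pauli1 R (xor1 a b).
Proof.
apply/matrixP => i j; rewrite !mxE !big_ord_recl big_ord0.
elim/I4_ind: a; elim/I4_ind: b; rewrite /pauli1 /om1 /=; rewrite !mxE;
  elim/I2_ind: i; elim/I2_ind: j; apply: complex_eq => /=; ring.
Qed.

Lemma om1C a b : om1 a b = (sg1 a b)%:C * om1 b a.
Proof.
by elim/I4_ind: a; elim/I4_ind: b; rewrite /om1 /sg1 /=; apply: complex_eq => /=; ring.
Qed.

Lemma om1_self a : om1 a a = 1.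
Proof. by elim/I4_ind: a. Qed.

Lemma sg1D a b b' : sg1 a (xor1 b b') = sg1 a b * sg1 a b'.
Proof.
by elim/I4_ind: a; elim/I4_ind: b; elim/I4_ind: b'; rewrite /sg1 /= ?mulr1 ?mulrNN ?mul1r.
Qed.

Lemma sg1C a b : sg1 a b = sg1 b a.
Proof. by elim/I4_ind: a; elim/I4_ind: b. Qed.

Lemma sum_sg1 b : \sum_a sg1 a b = 4%:R * (b == @Ordinal 4 0 isT)%:R.
Proof. by rewrite !big_ord_recl big_ord0; elim/I4_ind: b; rewrite /sg1 /=; ring. Qed.

Lemma sum_pauli1 i j k l :
  \sum_a pauli1 R a i j * pauli1 R a k l = 2%:R * (i == l)%:R * (j == k)%:R.
Proof.
rewrite !big_ord_recl big_ord0 /pauli1 /= !mxE.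
by elim/I2_ind: i; elim/I2_ind: j; elim/I2_ind: k; elim/I2_ind: l;
  rewrite /=; apply: complex_eq => /=; ring.
Qed.

Fixpoint om n : lab n -> lab n -> C :=
  if n is n'.+1 then fun t u : lab n'.+1 =>
    om1 (thead t) (thead u) * @om n' [tuple of behead t] [tuple of behead u]
  else fun _ _ => 1.

(** The symplectic form of the label group, written multiplicatively: a symmetric bicharacter that
    measures the asymmetry of the cocycle [om]. *)
Fixpoint sg n : lab n -> lab n -> R :=
  if n is n'.+1 then fun t u : lab n'.+1 =>
    sg1 (thead t) (thead u) * @sg n' [tuple of behead t] [tuple of behead u]
  else fun _ _ => 1.

Lemma om_cons n a b (t u : lab n) : om (lcons a t) (lcons b u) = om1 a b * om t u.
Proof. by rewrite /= !theadE; congr (_ * om _ _); apply: val_inj. Qed.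

Lemma sg_cons n a b (t u : lab n) : sg (lcons a t) (lcons b u) = sg1 a b * sg t u.
Proof. by rewrite /= !theadE; congr (_ * sg _ _); apply: val_inj. Qed.

(* Locked so that rewriting with [castmxE] does not see the cast inside. *)
Fact pm_key : unit. Proof. by []. Qed.
Definition pm n (t : lab n) : 'M[C]_(2 ^ n) := locked_with pm_key
  (castmx (congr1 (expn 2) (size_tuple t), congr1 (expn 2) (size_tuple t)) (pauli_seq R t)).

Lemma pm_lab0 (t : lab 0) : pm t = 1%:M.
Proof.
by rewrite [t]tuple0 /pm unlock /= castmx1.
Qed.

Lemma pm_cons n a (t : lab n) :
  pm (lcons a t) = castmx (esym (expnS 2 n), esym (expnS 2 n)) (pauli1 R a *t pm t).
Proof.
have e2 : (2 * 2 ^ size t = 2 * 2 ^ n)%N by rewrite size_tuple.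
rewrite /pm !unlock /= (tens_castr _ _ e2 e2) !castmx_comp; congr castmx.
by congr pair; apply: eq_irrelevance.
Qed.

Lemma pauli_mxE n (P : pauli_op n) : pauli_mx R P = 'i ^+ val P.1 *: pm P.2.
Proof. by rewrite /pm unlock. Qed.

Lemma pm_adj n (t : lab n) : adj (pm t) = pm t.
Proof.
elim: n t => [|n IH] t; first by rewrite !pm_lab0 adj1.
by case: (labP t) => a {}t; rewrite !pm_cons adj_castmx adj_tens pauli1_adj IH.
Qed.

Lemma pmM n (t u : lab n) : pm t *m pm u = om t u *: pm (t + u).
Proof.
elim: n t u => [|n IH] t u; first by rewrite !pm_lab0 mulmx1 scale1r.
case: (labP t) => a {}t; case: (labP u) => b {}u.
rewrite lconsD om_cons !pm_cons -castmxM -castmxZ tensmx_mul pauli1M IH.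
by rewrite tensmxZ.
Qed.

Lemma omC n (t u : lab n) : om t u = (sg t u)%:C * om u t.
Proof.
elim: n t u => [|n IH] t u; first by rewrite /= mulr1.
case: (labP t) => a {}t; case: (labP u) => b {}u.
by rewrite !om_cons sg_cons rmorphM /= om1C IH mulrACA.
Qed.

Lemma om_self n (t : lab n) : om t t = 1.
Proof.
elim: n t => [|n IH] t //; case: (labP t) => a {}t.
by rewrite om_cons om1_self IH mulr1.
Qed.

Lemma pm0 n : pm (0 : lab n) = 1%:M.
Proof.
elim: n => [|n IH]; first exact: pm_lab0.
by rewrite -lcons0 pm_cons IH -(castmx1 C (esym (expnS 2 n))) -tens1mx1.
Qed.

Lemma pmK n (t : lab n) : pm t *m pm t = 1%:M.
Proof. by rewrite pmM om_self scale1r labDD pm0. Qed.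

Lemma sgDr n (t u v : lab n) : sg t (u + v) = sg t u * sg t v.
Proof.
elim: n t u v => [|n IH] t u v; first by rewrite /= mulr1.
case: (labP t) => a {}t; case: (labP u) => b {}u; case: (labP v) => d {}v.
by rewrite lconsD !sg_cons sg1D IH mulrACA.
Qed.

Lemma sgC n (t u : lab n) : sg t u = sg u t.
Proof.
elim: n t u => [|n IH] t u //.
by case: (labP t) => a {}t; case: (labP u) => b {}u; rewrite !sg_cons sg1C IH.
Qed.

Lemma sgDl n (t u v : lab n) : sg (u + v) t = sg u t * sg v t.
Proof. by rewrite ![sg _ t]sgC sgDr. Qed.

Lemma sg_self n (t : lab n) : sg t t = 1.
Proof. by have := omC t t; rewrite om_self mulr1 => /complexI. Qed.

Lemma sgr0 n (t : lab n) : sg t 0 = 1.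
Proof. by rewrite -(labDD t) sgDr sg_self mulr1. Qed.

Lemma sg_sq n (t u : lab n) : sg t u * sg t u = 1.
Proof. by rewrite -sgDr labDD sgr0. Qed.

Lemma sum_sg n (u : lab n) : \sum_t sg t u = (4 ^ n)%:R * (u == 0)%:R.
Proof.
elim: n u => [|n IH] u; first by rewrite big_lab0 [u]lab_eq0 eqxx mulr1.
case: (labP u) => b {}u; rewrite -lcons0 lcons_eq big_lcons expnS.
transitivity (\sum_a sg1 a b * \sum_t sg t u).
  by apply: eq_bigr => a _; rewrite mulr_sumr; apply: eq_bigr => t _; rewrite sg_cons.
by rewrite -mulr_suml sum_sg1 IH -mulnb !natrM mulrACA.
Qed.

(** Entrywise form of the fact that the sum of P x P over all Pauli strings P is 2^n times the swap
    of two copies. *)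
Lemma sum_pm n i j k l :
  \sum_(t : lab n) pm t i j * pm t k l = (2 ^ n)%:R * (i == l)%:R * (j == k)%:R.
Proof.
elim: n i j k l => [|n IH] i j k l.
  by rewrite big_lab0 pm_lab0 !mxE !ord1 eqxx !mulr1.
pose e := expnS 2 n.
rewrite -(cast_ordK e i) -(cast_ordK e j) -(cast_ordK e k) -(cast_ordK e l).
move: (cast_ord e i) (cast_ord e j) (cast_ord e k) (cast_ord e l) => i' j' k' l'.
rewrite !(inj_eq (@cast_ord_inj _ _ _)).
case: (mxtens_indexP i') => i1 i2; case: (mxtens_indexP j') => j1 j2.
case: (mxtens_indexP k') => k1 k2; case: (mxtens_indexP l') => l1 l2.
rewrite !(can_eq (@mxtens_indexK _ _)) !xpair_eqE big_lcons.
transitivity (\sum_a pauli1 R a i1 j1 * pauli1 R a k1 l1 *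
   \sum_(t : lab n) pm t i2 j2 * pm t k2 l2).
  apply: eq_bigr => a _; rewrite mulr_sumr; apply: eq_bigr => t _.
  by rewrite pm_cons !castmxE esymK !cast_ordKV !tensmxE mulrACA.
rewrite -mulr_suml sum_pauli1 IH expnS -!mulnb !natrM.
by ring.
Qed.

Lemma pm_lcat a b (t : lab a) (u : lab b) :
  pm (lcat t u) = castmx (esym (expnD 2 a b), esym (expnD 2 a b)) (pm t *t pm u).
Proof.
elim: a t => [|a IH] t.
  rewrite pm_lab0; have -> : lcat t u = u by apply: val_inj; rewrite [t]lab_eq0.
  apply/matrixP => i j; rewrite castmxE.
  set i' := cast_ord _ i; set j' := cast_ord _ j.
  have -> : i' = mxtens_index (ord0, i) by apply: val_inj.
  have -> : j' = mxtens_index (ord0, j) by apply: val_inj.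
  by rewrite tensmxE mxE eqxx mul1r.
case: (labP t) => x {}t.
have -> : lcat (lcons x t) u = lcons x (lcat t u) by exact: val_inj.
rewrite (@pm_cons (a + b)) pm_cons IH.
rewrite (tens_castr _ _ (congr1 (muln 2) (esym (expnD 2 a b))) (congr1 (muln 2) (esym (expnD 2 a b)))).
have e1 : (2 * 2 ^ a * 2 ^ b = 2 ^ a.+1 * 2 ^ b)%N by rewrite expnS.
rewrite (tens_castl _ _ e1 e1) -tensmxA !castmx_comp.
by congr castmx; congr pair; apply: eq_irrelevance.
Qed.

Lemma om_lcat a b (t t' : lab a) (u u' : lab b) :
  om (lcat t u) (lcat t' u') = om t t' * om u u'.
Proof.
elim: a t t' => [|a IH] t t'.
  rewrite mul1r; congr om; apply: val_inj; first by rewrite [t]lab_eq0.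
  by rewrite [t']lab_eq0.
case: (labP t) => x {}t; case: (labP t') => x' {}t'.
have lcatS y (v : lab a) w : lcat (lcons y v) w = lcons y (lcat v w) :> lab (a + b).+1.
  exact: val_inj.
by rewrite !lcatS (@om_cons (a + b)) om_cons IH mulrA.
Qed.

Lemma pm_neq0 n (t : lab n) : pm t != 0.
Proof.
apply/eqP => pt0; have := pmK t; rewrite pt0 mul0mx => /matrixP.
have h : (0 < 2 ^ n)%N by rewrite expn_gt0.
move=> /(_ (Ordinal h) (Ordinal h)); rewrite !mxE eqxx => /eqP.
by rewrite eq_sym oner_eq0.
Qed.

Lemma pm_scalerI n (t : lab n) (x y : C) : x *: pm t = y *: pm t -> x = y.
Proof.
move=> /eqP; rewrite -subr_eq0 -scalerBl scaler_eq0 (negPf (pm_neq0 _)) orbF.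
by rewrite subr_eq0 => /eqP.
Qed.

Lemma omV n (t u : lab n) : om t u * om u t = 1.
Proof.
have : pm t *m (pm u *m pm u) *m pm t = 1%:M by rewrite pmK mulmx1 pmK.
rewrite !mulmxA pmM -mulmxA pmM -scalemxAl -scalemxAr scalerA [u + t]addrC pmK.
by rewrite -(pm0 n) -[RHS]scale1r => /pm_scalerI.
Qed.

Lemma pm_comm n (t u : lab n) : pm t *m pm u = (sg t u)%:C *: (pm u *m pm t).
Proof. by rewrite !pmM scalerA -omC [t + u]addrC. Qed.

End Pauli.

(** * Inner products and Pauli expectations *)

Section Dot.
Variable R : realType.
Local Notation C := R[i].

Definition dot N (u v : 'cV[C]_N) : C := (adj u *m v) 0 0.
Definition nrm2 N (v : 'cV[C]_N) : R := complex.Re (dot v v).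

Lemma dotE N (u v : 'cV[C]_N) : dot u v = \sum_i conjc (u i 0) * v i 0.
Proof. by rewrite /dot mxE; apply: eq_bigr => i _; rewrite adjE. Qed.

Lemma dotC N (u v : 'cV[C]_N) : dot v u = conjc (dot u v).
Proof. by rewrite /dot -adjE adjM adjK. Qed.

Lemma dotDr N (u v w : 'cV[C]_N) : dot u (v + w) = dot u v + dot u w.
Proof. by rewrite /dot mulmxDr mxE. Qed.
Lemma dotDl N (u v w : 'cV[C]_N) : dot (v + w) u = dot v u + dot w u.
Proof. by rewrite /dot adjD mulmxDl mxE. Qed.
Lemma dotZr N a (u v : 'cV[C]_N) : dot u (a *: v) = a * dot u v.
Proof. by rewrite /dot -scalemxAr mxE. Qed.
Lemma dotZl N a (u v : 'cV[C]_N) : dot (a *: u) v = conjc a * dot u v.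
Proof. by rewrite /dot adjZ -scalemxAl mxE. Qed.
Lemma dot_sumr N (I : Type) (r : seq I) (P : pred I) (u : 'cV[C]_N) (F : I -> 'cV[C]_N) :
  dot u (\sum_(i <- r | P i) F i) = \sum_(i <- r | P i) dot u (F i).
Proof. by rewrite /dot mulmx_sumr summxE. Qed.
Lemma dot_suml N (I : Type) (r : seq I) (P : pred I) (u : 'cV[C]_N) (F : I -> 'cV[C]_N) :
  dot (\sum_(i <- r | P i) F i) u = \sum_(i <- r | P i) dot (F i) u.
Proof. by rewrite /dot adj_sum mulmx_suml summxE. Qed.

Lemma dot_mulmxl M N (A : 'M[C]_(N, M)) (u : 'cV[C]_M) (v : 'cV[C]_N) :
  dot (A *m u) v = dot u (adj A *m v).
Proof. by rewrite /dot adjM mulmxA. Qed.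

Lemma dotvv N (v : 'cV[C]_N) : dot v v = (nrm2 v)%:C.
Proof. by rewrite RRe_real //; apply/CrealP; exact: (esym (dotC v v)). Qed.

Lemma dot_ge0 N (v : 'cV[C]_N) : 0 <= dot v v.
Proof. by rewrite dotE sumr_ge0 // => i _; rewrite mulrC mulcJ_ge0. Qed.

Lemma nrm2_ge0 N (v : 'cV[C]_N) : 0 <= nrm2 v.
Proof. by have := dot_ge0 v; rewrite dotvv ler0c. Qed.

Lemma nrm2_eq0 N (v : 'cV[C]_N) : (nrm2 v == 0) = (v == 0).
Proof.
apply/eqP/eqP => [v0|->]; last by rewrite /nrm2 /dot mulmx0 mxE.
apply/matrixP => i j; rewrite ord1 !mxE.
have /eqP : dot v v = 0 by rewrite dotvv v0.
rewrite dotE psumr_eq0 => [/allP/(_ i)|k _]; last by rewrite mulrC mulcJ_ge0.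
by rewrite mem_index_enum mulf_eq0 conjc_eq0 orbb => /(_ isT)/eqP.
Qed.

Lemma nrm2_gt0 N (v : 'cV[C]_N) : (0 < nrm2 v) = (v != 0).
Proof. by rewrite lt_def nrm2_ge0 andbT nrm2_eq0. Qed.

Lemma expectE N (v : 'cV[C]_N) A : expect v A = dot v (A *m v).
Proof. by rewrite /expect /dot mulmxA. Qed.

Definition normsq (z : C) : R := complex.Re z ^+ 2 + complex.Im z ^+ 2.

Lemma normsqE z : (normsq z)%:C = z * conjc z.
Proof. by case: z => a b; apply: complex_eq; rewrite /normsq /=; ring. Qed.

Lemma normsq_ge0 z : 0 <= normsq z.
Proof. by rewrite addr_ge0 // sqr_ge0. Qed.

Lemma normsqM y z : normsq (y * z) = normsq y * normsq z.
Proof. by case: y z => [a b] [c d]; rewrite /normsq /=; ring. Qed.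

Lemma normsqR (x : R) : normsq x%:C = x ^+ 2.
Proof. by rewrite /normsq /= expr0n addr0. Qed.

Lemma cauchy_schwarz N (u v : 'cV[C]_N) : normsq (dot u v) <= nrm2 u * nrm2 v.
Proof.
have [->|u0] := eqVneq u 0.
  by rewrite /nrm2 /dot /adj trmx0 map_mx0 !mul0mx !mxE /normsq /= expr0n addr0 mul0r.
(* This vector is |u|^2 times the component of [v] orthogonal to [u]. *)
have := nrm2_ge0 ((nrm2 u)%:C *: v - dot u v *: u).
have -> : nrm2 ((nrm2 u)%:C *: v - dot u v *: u)
          = nrm2 u * (nrm2 u * nrm2 v - normsq (dot u v)).
  apply: complexI; rewrite -(dotvv (_ - _)) -scaleNr dotDr !dotDl !dotZr !dotZl !dotvv.
  rewrite !conjc_real [conjc (- _)]rmorphN (dotC u v) rmorphM rmorphB rmorphM.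
  rewrite /= normsqE.
  by ring.
by rewrite pmulr_rge0 ?nrm2_gt0 // subr_ge0.
Qed.
End Dot.

Section Expectation.
Variable R : realType.
Local Notation C := R[i].

(** Taking the real part loses nothing, since Pauli strings are Hermitian. *)
Definition ev n (v : 'cV[C]_(2 ^ n)) (t : lab n) : R := complex.Re (dot v (pm R t *m v)).

Lemma evE n (v : 'cV[C]_(2 ^ n)) t : dot v (pm R t *m v) = (ev v t)%:C.
Proof.
rewrite RRe_real //; apply/CrealP.
by apply: (etrans (esym (dotC _ _))); rewrite dot_mulmxl pm_adj.
Qed.

Lemma ev0 n (v : 'cV[C]_(2 ^ n)) : ev v 0 = nrm2 v.
Proof. by rewrite /ev pm0 mul1mx. Qed.

Lemma dot_pm n (v : 'cV[C]_(2 ^ n)) t u :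
  dot (pm R t *m v) (pm R u *m v) = om R t u * (ev v (t + u))%:C.
Proof. by rewrite dot_mulmxl pm_adj mulmxA pmM -scalemxAl dotZr evE. Qed.

(** The sum is the expectation of 2^n times the swap in two copies of [v], which the swap fixes. *)
Lemma sum_ev_sq n (v : 'cV[C]_(2 ^ n)) : \sum_t ev v t ^+ 2 = (2 ^ n)%:R * nrm2 v ^+ 2.
Proof.
apply: complexI; rewrite rmorph_sum rmorphM rmorphXn /= rmorph_nat -dotvv.
have E t : (ev v t)%:C = \sum_i \sum_j conjc (v i 0) * v j 0 * pm R t i j.
  rewrite -evE dotE; apply: eq_bigr => i _; rewrite mxE mulr_sumr.
  by apply: eq_bigr => j _; rewrite [pm R t i j * _]mulrC mulrA.
under eq_bigr => t _.
  rewrite rmorphXn /= expr2 E big_distrlr /=.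
  under eq_bigr => i _.
    under eq_bigr => k _.
      rewrite big_distrlr /=.
      over.
    over.
  over.
rewrite exchange_big /= expr2 dotE big_distrlr /= mulr_sumr; apply: eq_bigr => i _.
rewrite exchange_big /= mulr_sumr; apply: eq_bigr => k _.
rewrite exchange_big /=.
transitivity (\sum_j \sum_l conjc (v i 0) * v j 0 * (conjc (v k 0) * v l 0) *
   ((2 ^ n)%:R * (i == l)%:R * (j == k)%:R)).
  apply: eq_bigr => j _; rewrite exchange_big /=; apply: eq_bigr => l _.
  by rewrite -sum_pm mulr_sumr; apply: eq_bigr => t _; rewrite mulrACA.
rewrite (bigD1 k) //= [X in _ + X]big1 ?addr0; last first.
  by move=> j jk; apply: big1 => l _; rewrite (negPf jk) !mulr0.
rewrite (bigD1 i) //= [X in _ + X]big1 ?addr0; last first.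
  by move=> l li; rewrite eq_sym (negPf li) mulr0 mul0r mulr0.
by rewrite !eqxx !mulr1; ring.
Qed.
End Expectation.

(** * Stabilizer groups *)

(** Every label is its own inverse, so closure under addition makes a subgroup. *)
Definition lgrp n (L : {set lab n}) : Prop :=
  0 \in L /\ {in L &, forall l k, l + k \in L}.

Lemma lgrp_addr n (L : {set lab n}) l k : lgrp L -> l \in L -> (l + k \in L) = (k \in L).
Proof.
move=> [_ LD] lL; apply/idP/idP => [lk|]; last exact: LD.
by rewrite -(labKD l k) LD.
Qed.

Lemma lgrp_sum n (L : {set lab n}) (T : nmodType) (F : lab n -> T) l :
  lgrp L -> l \in L -> \sum_(k in L) F (l + k) = \sum_(k in L) F k.
Proof.
move=> gL lL; rewrite [RHS](reindex_inj (addrI l)) /=.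
by apply: eq_bigl => k; rewrite lgrp_addr.
Qed.

Section Codes.
Variable R : realType.
Local Notation C := R[i].

(* [l |-> s l *: pm (f l)] is a representation of [L]. *)
Definition srep m n (L : {set lab m}) (f : lab m -> lab n) (s : lab m -> R) : Prop :=
  s 0 = 1 /\
  {in L &, forall l k, (s l * s k)%:C * om R (f l) (f k) = (s (l + k))%:C}.

Section Srep.
Variables (m n : nat) (L : {set lab m}) (f : lab m -> lab n) (s : lab m -> R).
Hypotheses (gL : lgrp L) (rL : srep L f s).

Lemma srep_sq l : l \in L -> s l * s l = 1.
Proof.
move=> lL; apply: complexI; have [s0 sM] := rL.
by have := sM _ _ lL lL; rewrite om_self mulr1 labDD s0.
Qed.

Lemma srep_sg l k : l \in L -> k \in L -> sg R (f l) (f k) = 1.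
Proof.
move=> lL kL; apply: complexI; have [_ sM] := rL.
have := sM _ _ lL kL; rewrite addrC -(sM _ _ kL lL) mulrC [s l * s k]mulrC [RHS]mulrC.
have n0 i : i \in L -> s i != 0.
  by move=> iL; apply/eqP => h; have /eqP := srep_sq iL; rewrite h mul0r eq_sym oner_eq0.
have h : (s k * s l)%:C != 0 :> C by rewrite fmorph_eq0 mulf_neq0 ?n0.
move/(mulIf h); rewrite omC -[RHS]mul1r => /mulIf -> //.
by apply/eqP => h0; have /eqP := omV R (f k) (f l); rewrite h0 mul0r eq_sym oner_eq0.
Qed.

Hypothesis fD : {morph f : l k / l + k}.

(** The sum G of the signed Pauli strings is Hermitian with G^2 = |L| G: it is |L| times the
    projector onto the fixed space of the representation. *)
Lemma srep_nrm2 (v : 'cV[C]_(2 ^ n)) :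
  nrm2 (\sum_(l in L) (s l)%:C *: (pm R (f l) *m v)) =
  #|L|%:R * \sum_(l in L) s l * ev v (f l).
Proof.
apply: complexI; rewrite -dotvv dot_suml rmorphM rmorph_nat /= mulr_natl -sumr_const.
apply: eq_bigr => l lL; rewrite dot_sumr -(lgrp_sum (fun k => s k * ev v (f k)) gL lL).
rewrite rmorph_sum; apply: eq_bigr => k kL /=.
have [_ sM] := rL.
by rewrite dotZl dotZr conjc_real dot_pm rmorphM /= -(sM _ _ lL kL) fD rmorphM /=; ring.
Qed.

Lemma srep_ge0 (v : 'cV[C]_(2 ^ n)) : 0 <= \sum_(l in L) s l * ev v (f l).
Proof.
have := nrm2_ge0 (\sum_(l in L) (s l)%:C *: (pm R (f l) *m v)).
rewrite srep_nrm2 pmulr_rge0 // ltr0n card_gt0; apply/set0Pn; exists 0.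
by case: gL.
Qed.
End Srep.

(** The left side is |L| times the expectation of the code projector, which is why |L| multiplies
    under the root instead of dividing. *)
Definition aligned n (v : 'cV[C]_(2 ^ n)) (F : R) : Prop :=
  forall (L : {set lab n}) s, lgrp L -> srep L id s ->
    \sum_(l in L) s l * ev v l <= Num.sqrt ((2 ^ n)%:R * #|L|%:R) * F.

Section Stabl.
Variable n : nat.
Implicit Types (v : 'cV[C]_(2 ^ n)) (t : lab n).

(** Labels that stabilize [v] up to sign. Outside this set [sgn] takes the value -1, so that
    [sgn_sq] holds without side condition. *)
Definition stabl v : {set lab n} := [set t | (pm R t *m v == v) || (pm R t *m v == - v)].
Definition sgn v t : R := if pm R t *m v == v then 1 else -1.

Lemma stablP v t : t \in stabl v -> pm R t *m v = (sgn v t)%:C *: v.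
Proof.
rewrite inE /sgn; case: eqP => [->|_ /= /eqP ->]; first by rewrite scale1r.
by rewrite rmorphN scaleNr scale1r.
Qed.

Lemma stabl_eig v t (a : C) : v != 0 -> pm R t *m v = a *: v ->
  t \in stabl v /\ a = (sgn v t)%:C.
Proof.
move=> v0 e; have : (a * a) *: v = 1 *: v.
  by rewrite -scalerA -e scalemxAr -e mulmxA pmK mul1mx scale1r.
move/eqP; rewrite -subr_eq0 -scalerBl scaler_eq0 (negPf v0) orbF subr_eq0 -expr2 sqrf_eq1.
rewrite inE /sgn e; case/orP => /eqP ->; first by rewrite scale1r eqxx.
rewrite scaleN1r eqxx orbT; case: eqP => [/eqP|_]; last by rewrite rmorphN.
by rewrite eq_sym -addr_eq0 -mulr2n -scaler_nat scaler_eq0 (negPf v0) pnatr_eq0.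
Qed.

Lemma sgn_sq v t : sgn v t * sgn v t = 1.
Proof. by rewrite /sgn; case: ifP; rewrite ?mulr1 ?mulrNN ?mulr1. Qed.

(** Evaluating products of Pauli strings on the common eigenvector determines the phase: [om] must
    be the real sign s l s k s (l + k). *)
Lemma eigen_srep v (L : {set lab n}) s : v != 0 -> lgrp L ->
  {in L, forall t, pm R t *m v = (s t)%:C *: v} -> srep L id s.
Proof.
move=> v0 gL es; have [L0 LD] := gL.
have vI (a b : C) : a *: v = b *: v -> a = b.
  by move/eqP; rewrite -subr_eq0 -scalerBl scaler_eq0 (negPf v0) orbF subr_eq0 => /eqP.
have s2 l : l \in L -> s l * s l = 1.
  move=> lL; apply/complexI/vI; rewrite rmorphM /= -scalerA -es // scalemxAr -es //.
  by rewrite mulmxA pmK mul1mx scale1r.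
split.
  by apply/complexI/vI; rewrite -es // pm0 mul1mx scale1r.
move=> l k lL kL.
have e : (s l * s k)%:C = om R l k * (s (l + k))%:C.
  apply: vI; transitivity (pm R l *m (pm R k *m v)).
    by rewrite es // -scalemxAr es // scalerA -rmorphM mulrC.
  by rewrite mulmxA pmM -scalemxAl es ?LD // scalerA.
have -> : om R l k = (s l * s k * s (l + k))%:C.
  by rewrite rmorphM /= e -mulrA -rmorphM s2 ?LD // mulr1.
by rewrite -rmorphM /= mulrA mulrACA !s2 // !mul1r.
Qed.

Lemma stabl_lgrp v : v != 0 -> lgrp (stabl v).
Proof.
move=> v0; split; first by rewrite inE pm0 mul1mx eqxx.
move=> l k /stablP el /stablP ek.
have e : om R l k *: (pm R (l + k) *m v) = (sgn v l * sgn v k)%:C *: v.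
  by rewrite scalemxAl -pmM -mulmxA ek -scalemxAr el scalerA -rmorphM mulrC.
have e' : pm R (l + k) *m v = (om R k l * (sgn v l * sgn v k)%:C) *: v.
  by rewrite -scalerA -e scalerA omV scale1r.
by case: (stabl_eig v0 e').
Qed.

Lemma stabl_srep v : v != 0 -> srep (stabl v) id (sgn v).
Proof.
by move=> v0; apply: (eigen_srep v0 (stabl_lgrp v0)) => t; exact: stablP.
Qed.

Lemma ev_stabl v t : t \in stabl v -> ev v t = sgn v t * nrm2 v.
Proof. by move=> /stablP e; apply: complexI; rewrite -evE e dotZr dotvv rmorphM. Qed.

(** Each element of the stabilizer contributes |v|^4 to the total 2^n |v|^4 of [sum_ev_sq]. *)
Lemma card_stabl v : v != 0 -> (#|stabl v| <= 2 ^ n)%N.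
Proof.
move=> v0; rewrite -(ler_nat R).
have N0 : 0 < nrm2 v ^+ 2 by rewrite exprn_gt0 // nrm2_gt0.
rewrite -(ler_pM2r N0) -sum_ev_sq (bigID (mem (stabl v))) /=.
rewrite (eq_bigr (fun=> nrm2 v ^+ 2)) => [|t tv]; last first.
  by rewrite ev_stabl // exprMn expr2 sgn_sq mul1r.
by rewrite sumr_const -[X in _ <= X + _]mulr_natl lerDl sumr_ge0 // => t _; rewrite sqr_ge0.
Qed.

(** Commuting matrices share an eigenvector, and its eigenvalues are a consistent choice of signs
    for [L]. *)
Lemma sign_exists (L : {set lab n}) : lgrp L -> {in L &, forall l k, sg R l k = 1} ->
  exists2 v : 'cV[C]_(2 ^ n), v != 0 & L \subset stabl v.
Proof.
move=> gL cL.
have [||v v0 /allP vs] := @common_eigenvector _ _ [seq pm R t | t in L].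
- by rewrite expn_gt0.
- move=> _ _ /fintype.imageP[l lL ->] /fintype.imageP[k kL ->].
  by rewrite /comm_mx (pm_comm R l k) cL // scale1r.
(* The common eigenvector comes as a row vector, hence the adjoint. *)
exists (adj v).
  by apply: contraNneq v0 => h; rewrite -[v]adjK h; apply/eqP/matrixP => i j; rewrite !mxE conjc0.
apply/fintype.subsetP => t tL.
have /vs/sub_rVP[a e] : pm R t \in [seq pm R t | t in L] by apply: fintype.image_f.
have [||//] := @stabl_eig (adj v) t (conjc a).
  by apply: contraNneq v0 => h; rewrite -[v]adjK h; apply/eqP/matrixP => i j; rewrite !mxE conjc0.
by rewrite -adjZ -e adjM pm_adj.
Qed.

Lemma unit_vec_neq0 N (v : 'cV[C]_N) : unit_vec v -> v != 0.
Proof. by rewrite /unit_vec; apply: contra_eq_neq => ->; rewrite mulmx0 mxE eq_sym oner_eq0. Qed.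

Lemma unit_vecE N (v : 'cV[C]_N) : unit_vec v <-> nrm2 v = 1.
Proof.
rewrite /unit_vec; change ((adj v *m v) 0 0) with (dot v v); rewrite dotvv.
by split=> [/complexI|->].
Qed.

(** A string in [stabl v] fixes [v] with exactly one of the phases i^e, namely e = 0 or e = 2, and
    any other string with none; phases can thus be dropped from the count. *)
Lemma card_stab_group v : v != 0 ->
  #|[set P : pauli_op n | pauli_mx R P *m v == v]| = #|stabl v|.
Proof.
move=> v0; pose f t : pauli_op n :=
  (if pm R t *m v == v then @Ordinal 4 0 isT else @Ordinal 4 2 isT, t).
rewrite -(card_imset (mem (stabl v)) (f := f)); last by move=> t u [].
apply: eq_card => -[e t]; rewrite inE pauli_mxE /= -scalemxAl.
apply/eqP/imsetP => [h|[u us [-> ->]]]; last first.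
  by move: us; rewrite inE; case: eqP => [->|_ /= /eqP ->] //=; rewrite ?scale1r // sqr_i scaleN1r opprK.
have i4 : ('i : C) ^+ 4 = 1 by rewrite (exprM _ 2 2) sqr_i expr2 mulrNN mulr1.
have e' : pm R t *m v = ('i : C) ^+ (4 - e) *: v.
  by rewrite -[in RHS]h scalerA -exprD subnK ?i4 ?scale1r // ltnW.
have [ts p] := stabl_eig v0 e'; exists t => //; rewrite /f; congr (_, _).
have p1 := congr1 (@complex.Re R) p; have p2 := congr1 (@complex.Im R) p.
move: p1 p2; rewrite /sgn; case: ifP => _; elim/I4_ind: e {h e' p} => //=;
  rewrite ?exprS ?expr0 /= => p1 p2; exfalso; move: p1 p2; lra.
Qed.
End Stabl.
End Codes.

(** * Multiplicativity of alignment *)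

Section Tensor.
Variable R : realType.
Local Notation C := R[i].

Lemma sg_lcat a b (t t' : lab a) (u u' : lab b) :
  sg R (lcat t u) (lcat t' u') = sg R t t' * sg R u u'.
Proof.
elim: a t t' => [|a IH] t t'.
  rewrite mul1r; congr sg; apply: val_inj; first by rewrite [t]lab_eq0.
  by rewrite [t']lab_eq0.
case: (labP t) => x {}t; case: (labP t') => x' {}t'.
have lcatS y (v : lab a) w : lcat (lcons y v) w = lcons y (lcat v w) :> lab (a + b).+1.
  exact: val_inj.
by rewrite !lcatS (@sg_cons _ (a + b)) sg_cons IH mulrA.
Qed.

(** Conjugation by the Pauli string [w] multiplies the signs by the character [sg w]. *)
Lemma srep_twist m n (L : {set lab m}) (f : lab m -> lab n) s (w : lab n) :
  {morph f : l k / l + k} -> srep L f s -> srep L f (fun l => sg R w (f l) * s l).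
Proof.
move=> fD [s0 sM]; have f0 : f 0 = 0 by rewrite -(labDD 0) fD labDD.
split=> [|l k lL kL]; first by rewrite f0 sgr0 mul1r.
by rewrite mulrACA rmorphM -mulrA /= sM // fD sgDr -rmorphM.
Qed.

Lemma aligned_nrm2 n (v : 'cV[C]_(2 ^ n)) F :
  aligned v F -> nrm2 v <= Num.sqrt (2 ^ n)%:R * F.
Proof.
have g0 : lgrp [set (0 : lab n)].
  by split=> [|l k]; rewrite !inE // => /eqP -> /eqP ->; rewrite labDD.
have r0 : srep [set (0 : lab n)] id (fun=> 1 : R).
  by split=> // l k; rewrite !inE => /eqP -> /eqP ->; rewrite om_self !mulr1.
by move=> /(_ _ _ g0 r0); rewrite big_set1 mul1r ev0 cards1 mulr1.
Qed.

Lemma aligned_ge0 n (v : 'cV[C]_(2 ^ n)) F : aligned v F -> 0 <= F.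
Proof.
move=> /aligned_nrm2 /(le_trans (nrm2_ge0 v)); rewrite pmulr_rge0 // sqrtr_gt0.
by rewrite ltr0n expn_gt0.
Qed.

(** A nontrivial character of a group sums to zero: a shift by an element of value different from 1
    rescales the sum without changing it. *)
Lemma sum_sg_lgrp m n (L : {set lab m}) (f : lab m -> lab n) (t : lab n) :
  lgrp L -> {morph f : l k / l + k} ->
  \sum_(l in L) sg R t (f l) = #|L|%:R * [forall l in L, sg R t (f l) == 1]%:R.
Proof.
move=> gL fD; case: (boolP [forall l in L, _]) => [/forallP h|]; rewrite ?mulr1 ?mulr0.
  by rewrite -sumr_const; apply: eq_bigr => l lL; apply/eqP; move/implyP: (h l); exact.
rewrite negb_forall => /existsP[k]; rewrite negb_imply => /andP[kL n1].
set S := \sum_(l in L) _; suff : sg R t (f k) * S = S.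
  move/eqP; rewrite -subr_eq0 -[X in _ - X]mul1r -mulrBl mulf_eq0 subr_eq0.
  by rewrite (negPf n1) /= => /eqP.
rewrite mulr_sumr -[RHS](lgrp_sum _ gL kL); apply: eq_bigr => l lL.
by rewrite fD sgDr.
Qed.

Variables (a b : nat) (vA : 'cV[C]_(2 ^ a)) (vB : 'cV[C]_(2 ^ b)).
Variables (L : {set lab (a + b)}) (s : lab (a + b) -> R).
Hypotheses (gL : lgrp L) (rL : srep L id s).
Local Notation A := (@lfst a b).
Local Notation B := (@lsnd a b).
Let e (l : lab (a + b)) := ev vA (A l) * ev vB (B l).

(** Elements of [L] commute, so their signs on A and on B have product 1. Hence an element whose B
    part commutes with all others has the same property on A, and [lcenter] is symmetric in the two
    factors. *)
Lemma sgAB l k : l \in L -> k \in L -> sg R (A l) (A k) = sg R (B l) (B k).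
Proof.
move=> lL kL; have := srep_sg rL lL kL.
rewrite -{1}(lfst_snd l) -{1}(lfst_snd k) sg_lcat => h.
by rewrite -[LHS]mulr1 -(sg_sq R (B l) (B k)) mulrA h mul1r.
Qed.

Lemma srepAB l k : l \in L -> k \in L ->
  (s l * s k)%:C * (om R (A l) (A k) * om R (B l) (B k)) = (s (l + k))%:C.
Proof. by move=> lL kL; rewrite -om_lcat !lfst_snd; case: rL => _; exact. Qed.

Lemma mxtrace_adj_ge0 M N (X : 'M[C]_(M, N)) : 0 <= \tr (adj X *m X).
Proof.
apply: sumr_ge0 => i _; rewrite mxE sumr_ge0 // => j _.
by rewrite adjE mulrC mulcJ_ge0.
Qed.

Lemma mxtrace_rank1 M N (u u' : 'cV[C]_M) (w w' : 'cV[C]_N) :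
  \tr (adj (u *m adj w) *m (u' *m adj w')) = dot u u' * dot w' w.
Proof.
rewrite adjM adjK mulmxA -(mulmxA w) (mx11_scalar (adj u *m u')) mul_mx_scalar.
by rewrite -scalemxAl mxtraceZ mxtrace_mulC /mxtrace big_ord1.
Qed.

(* The Gram matrix of the rank one operators [A_l vA (B_l vB)^*] is positive. *)
Lemma gram_ge0 (c : lab (a + b) -> R) :
  0 <= \sum_(l in L) \sum_(k in L)
         c l * c k * sg R (B l) (B k) * (s (l + k) * e (l + k)).
Proof.
pose X l := (c l * s l)%:C *: ((pm R (A l) *m vA) *m adj (pm R (B l) *m vB)).
rewrite -ler0c; have := mxtrace_adj_ge0 (\sum_(l in L) X l).
rewrite adj_sum mulmx_suml raddf_sum /= rmorph_sum /=; congr (0 <= _).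
apply: eq_bigr => l lL; rewrite mulmx_sumr raddf_sum /= rmorph_sum /=.
apply: eq_bigr => k kL.
rewrite adjZ conjc_real -scalemxAl -scalemxAr !mxtraceZ mxtrace_rank1 !dot_pm.
rewrite (omC R (B k)) [sg _ (B k) _]sgC [B k + _]addrC !rmorphM /= -(srepAB lL kL).
by rewrite lfstD lsndD !rmorphM /=; ring.
Qed.

Definition lcenter : {set lab (a + b)} :=
  [set l in L | [forall k in L, sg R (B l) (B k) == 1]].
Local Notation Z := lcenter.

Lemma lcenterP l k : l \in Z -> k \in L -> sg R (B l) (B k) = 1.
Proof. by rewrite inE => /andP[_ /forallP/(_ k)/implyP h] /h/eqP. Qed.

Lemma lcenter_sub l : l \in Z -> l \in L.
Proof. by rewrite inE => /andP[]. Qed.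

Lemma lsnd0 : B 0 = 0.
Proof. by rewrite -(labDD 0) lsndD labDD. Qed.
Lemma lfst0 : A 0 = 0.
Proof. by rewrite -(labDD 0) lfstD labDD. Qed.

Lemma lcenter_lgrp : lgrp Z.
Proof.
have [L0 LD] := gL; split.
  by rewrite inE L0; apply/forallP => k; rewrite lsnd0 sgC sgr0 eqxx implybT.
move=> l k lZ kZ; rewrite inE LD ?lcenter_sub //=.
by apply/forallP => i; apply/implyP => iL; rewrite lsndD sgDl !lcenterP // mulr1.
Qed.

Lemma sum_sg_center m : m \in L ->
  \sum_(l in L) sg R (B l) (B m) = #|L|%:R * (m \in Z)%:R.
Proof.
move=> mL; rewrite inE mL -(sum_sg_lgrp _ gL (@lsndD a b)).
by apply: eq_bigr => l _; rewrite sgC.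
Qed.

(** Tested on the coefficients alpha 1_Z - beta, [gram_ge0] says that (alpha^2 |Z| + beta^2 |L|)
    times the sum over Z is at least 2 alpha beta |Z| times the sum over L. This is sharpest for
    alpha^2 |Z| = beta^2 |L|, whence alpha = sqrt |L| and beta = sqrt |Z|. *)
Lemma restrict_center :
  Num.sqrt #|Z|%:R * \sum_(l in L) s l * e l <= Num.sqrt #|L|%:R * \sum_(l in Z) s l * e l.
Proof.
set x := Num.sqrt #|L|%:R; set y := Num.sqrt #|Z|%:R.
have card_gt0R (D : {set lab (a + b)}) : lgrp D -> (0 : R) < #|D|%:R.
  by case=> D0 _; rewrite ltr0n card_gt0; apply/set0Pn; exists 0.
have L0 := card_gt0R _ gL; have Z0 := card_gt0R _ lcenter_lgrp.
have x0 : 0 < x by rewrite sqrtr_gt0.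
have x2 : x * x = #|L|%:R by rewrite -expr2 sqr_sqrtr // ltW.
have y2 : y * y = #|Z|%:R by rewrite -expr2 sqr_sqrtr // ltW.
pose h l := s l * e l; rewrite -/h.
pose K l k := sg R (B l) (B k) * h (l + k).
have ZL (F : lab (a + b) -> R) : \sum_(l in L) (l \in Z)%:R * F l = \sum_(l in Z) F l.
  rewrite (bigID (mem Z)) /= [X in _ + X]big1 ?addr0; last first.
    by move=> l /andP[_ /negPf ->]; rewrite mul0r.
  apply: eq_big => [l|l /andP[_ ->]]; last by rewrite mul1r.
  by apply: andb_idl => /lcenter_sub.
have SL l : l \in Z -> \sum_(k in L) K l k = \sum_(k in L) h k.
  move=> lZ; rewrite -(lgrp_sum h gL (lcenter_sub lZ)); apply: eq_bigr => k kL.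
  by rewrite /K lcenterP // mul1r.
have SZ l : l \in Z -> \sum_(k in Z) K l k = \sum_(k in Z) h k.
  move=> lZ; rewrite -(lgrp_sum h lcenter_lgrp lZ); apply: eq_bigr => k kZ.
  by rewrite /K lcenterP ?lcenter_sub // mul1r.
have KC l k : K l k = K k l by rewrite /K sgC addrC.
have S1 : \sum_(l in L) \sum_(k in L) (l \in Z)%:R * ((k \in Z)%:R * K l k)
          = #|Z|%:R * \sum_(l in Z) h l.
  under eq_bigr => l _ do rewrite -mulr_sumr ZL.
  by rewrite ZL (eq_bigr _ SZ) sumr_const mulr_natl.
have S2 : \sum_(l in L) \sum_(k in L) (l \in Z)%:R * K l k = #|Z|%:R * \sum_(l in L) h l.
  under eq_bigr => l _ do rewrite -mulr_sumr.
  by rewrite ZL (eq_bigr _ SL) sumr_const mulr_natl.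
have S3 : \sum_(l in L) \sum_(k in L) (k \in Z)%:R * K l k = #|Z|%:R * \sum_(l in L) h l.
  by rewrite exchange_big -S2; apply: eq_bigr => l _; apply: eq_bigr => k _; rewrite KC.
(* After shifting k by l the sign is a character in l, whose sum vanishes unless k lies in [Z]. *)
have S4 : \sum_(l in L) \sum_(k in L) K l k = #|L|%:R * \sum_(l in Z) h l.
  transitivity (\sum_(l in L) \sum_(k in L) sg R (B l) (B k) * h k).
    apply: eq_bigr => l lL.
    rewrite -(lgrp_sum (fun k => sg R (B l) (B k) * h k) gL lL); apply: eq_bigr => k kL.
    by rewrite lsndD sgDr sg_self mul1r.
  rewrite exchange_big -ZL mulr_sumr /=; apply: eq_bigr => k kL.
  by rewrite -mulr_suml sum_sg_center // mulrA.
have := gram_ge0 (fun l => x * (l \in Z)%:R - y).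
have -> : \sum_(l in L) \sum_(k in L) (x * (l \in Z)%:R - y) * (x * (k \in Z)%:R - y) *
      sg R (B l) (B k) * (s (l + k) * e (l + k)) =
   2%:R * x * y * y * (x * (\sum_(l in Z) h l) - y * (\sum_(l in L) h l)).
  transitivity (x * x * (\sum_(l in L) \sum_(k in L) (l \in Z)%:R * ((k \in Z)%:R * K l k))
    - x * y * (\sum_(l in L) \sum_(k in L) (l \in Z)%:R * K l k)
    - x * y * (\sum_(l in L) \sum_(k in L) (k \in Z)%:R * K l k)
    + y * y * (\sum_(l in L) \sum_(k in L) K l k)).
    rewrite !mulr_sumr -!sumrB -big_split /=; apply: eq_bigr => l _.
    rewrite !mulr_sumr -!sumrB -big_split /=; apply: eq_bigr => k _.
    by rewrite /K /h; ring.
  by rewrite S1 S2 S3 S4 -x2 -y2; ring.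
rewrite -(mulrA (2%:R * x)) y2 pmulr_rge0 ?subr_ge0 //.
by rewrite !mulr_gt0.
Qed.

(** * The sum over the center *)

Section Center.
Variables FA FB : R.
Hypotheses (alA : aligned vA FA) (alB : aligned vB FB).
Local Notation Z := lcenter.
Let gZ : lgrp Z := lcenter_lgrp.
Let ZA : {set lab a} := A @: Z.
(** The kernel of the restriction of [Z] to A, whose image is [ZA]. *)
Let K : {set lab (a + b)} := [set z in Z | A z == 0].

Let inK z : (z \in K) = (z \in Z) && (A z == 0).
Proof. exact: finset.in_set. Qed.

Let K_lgrp : lgrp K.
Proof.
have [Z0 ZD] := gZ; split=> [|l k]; first by rewrite inK Z0 lfst0 eqxx.
rewrite !inK => /andP[lZ /eqP l0] /andP[kZ /eqP k0].
by rewrite ZD // lfstD l0 k0 addr0 eqxx.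
Qed.

Let ZA_lgrp : lgrp ZA.
Proof.
have [Z0 ZD] := gZ; split=> [|_ _ /imsetP[l lZ ->] /imsetP[k kZ ->]].
  by apply/imsetP; exists 0; rewrite ?lfst0.
by apply/imsetP; exists (l + k); rewrite ?lfstD // ZD.
Qed.

Let card_Z : #|Z| = (#|ZA| * #|K|)%N.
Proof.
rewrite -sum1_card (partition_big_imset (@lfst a b)) /= -sum_nat_const.
apply: eq_bigr => _ /imsetP[l lZ ->]; rewrite -[RHS]sum1_card.
rewrite (reindex_inj (addrI l)) /=; apply: eq_bigl => k.
by rewrite (lgrp_addr _ gZ lZ) lfstD inK -subr_eq0 addrAC subrr add0r.
Qed.

(** Elements of [K] are trivial on A, so [s] makes their B parts a stabilizer group on B, to which
    the alignment of [vB] applies. *)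
Let sum_K :
  \sum_(z in K) s z * ev vB (B z) <= Num.sqrt ((2 ^ b)%:R * #|K|%:R) * FB.
Proof.
have Bcat z : z \in K -> z = lcat 0 (B z).
  by rewrite inK => /andP[_ /eqP <-]; rewrite lfst_snd.
have Binj : {in K &, injective B} by move=> z y /Bcat -> /Bcat ->; rewrite !(lcatK _ _).2 => ->.
have KL z : z \in K -> z \in L by rewrite inK => /andP[/lcenter_sub].
pose sK y := s (lcat 0 y).
have := alB (L := B @: K) (s := sK); rewrite big_imset //= card_in_imset //.
have -> : \sum_(z in K) sK (B z) * ev vB (B z) = \sum_(z in K) s z * ev vB (B z).
  by apply: eq_bigr => z zK; rewrite /sK -Bcat.
have [K0 KD] := K_lgrp; apply.
  split; first by apply/imsetP; exists 0; rewrite ?lsnd0.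
  move=> _ _ /imsetP[l lK ->] /imsetP[k kK ->].
  by apply/imsetP; exists (l + k); rewrite ?lsndD // KD.
split; first by rewrite /sK -lsnd0 -Bcat //; case: rL.
move=> _ _ /imsetP[l lK ->] /imsetP[k kK ->].
rewrite /sK -lsndD -!Bcat ?KD // -srepAB ?KL //.
by move: lK kK; rewrite !inK => /andP[_ /eqP ->] /andP[_ /eqP ->]; rewrite om_self mul1r.
Qed.

(** The restrictions of [Z] to A commute and can be measured jointly on [vA]. Up to normalization,
    [p w] is the weight of the outcome [w] and [x w] the nonnegative weight left on B given that
    outcome. The alignment of [vA] bounds all [p w] uniformly; in the remaining sum of the [x w]
    only [K] survives, by orthogonality of characters. *)
Lemma center_bound :
  \sum_(z in Z) s z * e z <= Num.sqrt ((2 ^ (a + b))%:R * #|Z|%:R) * (FA * FB).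
Proof.
have ZL z : z \in Z -> z \in L by exact: lcenter_sub.
have [u u0 /fintype.subsetP ZAu] : exists2 u : 'cV[C]_(2 ^ a), u != 0 & ZA \subset stabl u.
  apply: sign_exists => // _ _ /imsetP[l lZ ->] /imsetP[k kZ ->].
  by rewrite sgAB ?ZL // lcenterP // ZL.
pose s' := sgn u.
have rA : srep ZA id s' by apply: (eigen_srep u0 ZA_lgrp) => t /ZAu/stablP.
have rB : srep Z B (fun z => s' (A z) * s z).
  have [s'0 s'M] := rA; have [s0 _] := rL.
  split=> [|l k lZ kZ]; first by rewrite lfst0 s'0 s0 mulr1.
  have hX := s'M _ _ (imset_f _ lZ) (imset_f _ kZ); rewrite -lfstD in hX.
  have hY := srepAB (ZL _ lZ) (ZL _ kZ).
  rewrite [RHS]rmorphM /= -hX -hY mulrACA [in LHS]rmorphM /=.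
  (* The phase of commuting A parts squares to 1, so the signs [s'] cancel the A phase of [s] and a
     representation on B alone remains. *)
  have oo : om R (A l) (A k) * om R (A l) (A k) = 1.
    by rewrite {2}omC sgAB ?ZL // lcenterP ?ZL // mul1r omV.
  transitivity ((s' (A l) * s' (A k))%:C * (s l * s k)%:C * om R (B l) (B k) *
    (om R (A l) (A k) * om R (A l) (A k))); first by rewrite oo mulr1.
  by ring.
(* Here [w] runs over all labels on A, not over the characters of [ZA]; each character occurs
   equally often, and the resulting factor 4^a cancels at the end. *)
pose p w := \sum_(x in ZA) (sg R w x * s' x) * ev vA x.
pose x w := \sum_(z in Z) (sg R w (A z) * (s' (A z) * s z)) * ev vB (B z).
have p_le w : p w <= Num.sqrt ((2 ^ a)%:R * #|ZA|%:R) * FA.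
  by apply: alA => //; apply: srep_twist.
have x_ge0 w : 0 <= x w.
  apply: (srep_ge0 gZ) (@lsndD a b) _; split=> [|l k lZ kZ].
    by rewrite (proj1 rB) lfst0 sgr0 mulr1.
  rewrite mulrACA rmorphM -mulrA /= (rB.2 _ _ lZ kZ) -rmorphM.
  by rewrite lfstD sgDr.
have xE w : x w = \sum_(z in Z) sg R w (A z) * (s' (A z) * s z * ev vB (B z)).
  by apply: eq_bigr => z _; rewrite -!mulrA.
have s'0 : s' 0 = 1 by case: rA.
have Sx : \sum_w x w = (4 ^ a)%:R * \sum_(z in K) s z * ev vB (B z).
  under eq_bigr => w _ do rewrite xE.
  rewrite exchange_big /= mulr_sumr big_mkcond [RHS]big_mkcond /=; apply: eq_bigr => z _.
  rewrite inK; case: (z \in Z) => //=.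
  rewrite -mulr_suml sum_sg; case: eqP => [->|_]; last by rewrite mulr0 mul0r.
  by rewrite s'0 mul1r mulr1.
have Spx : \sum_w p w * x w = (4 ^ a)%:R * \sum_(z in Z) s z * e z.
  transitivity (\sum_w \sum_(z in Z) \sum_(y in ZA) sg R w (y + A z) *
     (s' y * ev vA y * (s' (A z) * s z * ev vB (B z)))).
    apply: eq_bigr => w _; rewrite xE mulr_sumr; apply: eq_bigr => z _.
    by rewrite mulr_suml; apply: eq_bigr => y _; rewrite sgDr; ring.
  rewrite exchange_big mulr_sumr /=; apply: eq_bigr => z zZ.
  rewrite exchange_big /= (bigD1 (A z)) ?imset_f //= [X in _ + X]big1 ?addr0.
    rewrite -mulr_suml sum_sg labDD eqxx mulr1 /e; congr (_ * _).
    transitivity (s' (A z) * s' (A z) * (s z * (ev vA (A z) * ev vB (B z)))); first by ring.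
    by rewrite /s' sgn_sq mul1r.
  move=> y /andP[_ yz]; rewrite -mulr_suml sum_sg.
  by rewrite -[y + A z]/(y - A z) subr_eq0 (negPf yz) mulr0 mul0r.
have h4 : (0 : R) < (4 ^ a)%:R by rewrite ltr0n expn_gt0.
have FA0 := aligned_ge0 alA.
rewrite -(ler_pM2l h4) -Spx.
have -> : (4 ^ a)%:R * (Num.sqrt ((2 ^ (a + b))%:R * #|Z|%:R) * (FA * FB)) =
  Num.sqrt ((2 ^ a)%:R * #|ZA|%:R) * FA *
   ((4 ^ a)%:R * (Num.sqrt ((2 ^ b)%:R * #|K|%:R) * FB)).
  have -> : (2 ^ (a + b))%:R * #|Z|%:R =
      ((2 ^ a)%:R * #|ZA|%:R) * ((2 ^ b)%:R * #|K|%:R) :> R.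
    by rewrite expnD card_Z !natrM mulrACA.
  rewrite (sqrtrM ((2 ^ b)%:R * #|K|%:R)) ?mulr_ge0 ?ler0n //; ring.
apply: (@le_trans _ _ (Num.sqrt ((2 ^ a)%:R * #|ZA|%:R) * FA * \sum_w x w)).
  by rewrite mulr_sumr ler_sum // => w _; rewrite ler_wpM2r.
rewrite Sx ler_wpM2l ?mulr_ge0 ?sqrtr_ge0 // ler_wpM2l // ltW //.
Qed.
End Center.
End Tensor.

(** * Product vectors *)

Lemma dot_tens (R : realType) M N (u u' : 'cV[R[i]]_M) (v v' : 'cV[R[i]]_N) :
  dot (u *t v : 'cV_(M * N)) (u' *t v' : 'cV_(M * N)) = dot u u' * dot v v'.
Proof.
have e : adj (u *t v : 'cV_(M * N)) *m (u' *t v' : 'cV_(M * N))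
    = ((adj u *m u') *t (adj v *m v') : 'M_1).
  exact: etrans (congr1 (fun X => X *m (u' *t v')) (adj_tens u v)) (tensmx_mul _ _ _ _).
rewrite /dot e -tensmxE; congr (fun_of_matrix _ _ _); exact: val_inj.
Qed.

Definition vtens (R : realType) a b (u : 'cV[R[i]]_(2 ^ a)) (v : 'cV[R[i]]_(2 ^ b)) :
    'cV[R[i]]_(2 ^ (a + b)) :=
  castmx (esym (expnD 2 a b), erefl) (u *t v : 'cV_(2 ^ a * 2 ^ b)).

Lemma castmx_mul_col (R : realType) M N (e : M = N) (X : 'M[R[i]]_M) (u : 'cV[R[i]]_M) :
  castmx (e, e) X *m castmx (e, erefl) u = castmx (e, erefl) (X *m u).
Proof. by case: N / e. Qed.

Lemma dot_castmx (R : realType) M N (e : M = N) (u v : 'cV[R[i]]_M) :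
  dot (castmx (e, erefl) u) (castmx (e, erefl) v) = dot u v.
Proof. by case: N / e. Qed.

Lemma pm_vtens (R : realType) a b (u : 'cV[R[i]]_(2 ^ a)) (v : 'cV[R[i]]_(2 ^ b)) t t' :
  pm R (lcat t t') *m vtens u v = vtens (pm R t *m u) (pm R t' *m v).
Proof.
by rewrite pm_lcat /vtens castmx_mul_col (tensmx_mul _ _ u v).
Qed.

Lemma dot_vtens (R : realType) a b (u u' : 'cV[R[i]]_(2 ^ a)) (v v' : 'cV[R[i]]_(2 ^ b)) :
  dot (vtens u v) (vtens u' v') = dot u u' * dot v v'.
Proof. by rewrite /vtens dot_castmx dot_tens. Qed.

Lemma ev_vtens (R : realType) a b (u : 'cV[R[i]]_(2 ^ a)) (v : 'cV[R[i]]_(2 ^ b)) l :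
  ev (vtens u v) l = ev u (lfst l) * ev v (lsnd l).
Proof.
apply: complexI; rewrite -evE rmorphM /= -!evE -{1}(lfst_snd l) pm_vtens.
exact: dot_vtens.
Qed.

Theorem aligned_vtens (R : realType) a b (u : 'cV[R[i]]_(2 ^ a)) (v : 'cV[R[i]]_(2 ^ b)) F G :
  aligned u F -> aligned v G -> aligned (vtens u v) (F * G).
Proof.
move=> aF aG L s gL rL.
under eq_bigr => l _ do rewrite ev_vtens.
have h1 := restrict_center u v gL rL.
have h2 := center_bound gL rL aF aG.
have Z0 : (0 : R) < Num.sqrt #|lcenter R L|%:R.
  by rewrite sqrtr_gt0 ltr0n card_gt0; apply/set0Pn; exists 0; case: (lcenter_lgrp R gL).
rewrite -(ler_pM2l Z0); apply: (le_trans h1).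
apply: (le_trans (ler_wpM2l (sqrtr_ge0 _) h2)).
rewrite !sqrtrM ?ler0n // le_eqVlt; apply/orP; left; apply/eqP.
by rewrite -!/(Num.sqrt _); ring.
Qed.

(** * Stabilizer fidelity on few qubits *)

Section Fidelity.
Variable R : realType.
Local Notation C := R[i].

Lemma stab_vecP n (v : 'cV[C]_(2 ^ n)) :
  stab_vec v <-> nrm2 v = 1 /\ #|stabl v| = (2 ^ n)%N.
Proof.
split=> [[u c]|[u c]].
  by split; [apply/unit_vecE | rewrite -c card_stab_group ?unit_vec_neq0].
have uv : unit_vec v by apply/unit_vecE.
by split=> //; rewrite card_stab_group ?unit_vec_neq0.
Qed.

(** The signs are summed over all pairs in both orders: one order leaves only t in the commutant,
    the other only l = 0. *)
Lemma card_commutant n (L : {set lab n}) : lgrp L ->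
  (#|[set t | [forall l in L, sg R t l == 1]]| * #|L|)%:R = ((2 ^ n)%:R : R) ^+ 2.
Proof.
move=> gL; transitivity (\sum_(t : lab n) \sum_(l in L) sg R t l).
  rewrite natrM mulr_natl -sumr_const big_mkcond /=; apply: eq_bigr => t _.
  rewrite (@sum_sg_lgrp _ _ _ _ id) // inE; case: ifP => _; first by rewrite mulr1.
  by rewrite mulr0.
rewrite exchange_big /= (bigD1 0) /=; last by case: gL.
rewrite sum_sg eqxx mulr1 big1 ?addr0 => [|l /andP[_ l0]].
  by rewrite -natrX -expnM mulnC expnM.
by rewrite sum_sg (negPf l0) mulr0.
Qed.

(** By [card_commutant] the order divides 4^n. *)
Lemma lgrp_card n (L : {set lab n}) : lgrp L -> exists j, #|L| = (2 ^ j)%N.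
Proof.
move=> /card_commutant; rewrite -natrX => /eqP; rewrite eqr_nat -expnM => /eqP e.
have /(dvdn_pfactor _ _ (isT : prime 2))[j _ ->] : (#|L| %| 2 ^ (n * 2))%N.
  by rewrite -e dvdn_mull.
by exists j.
Qed.

(* [c]: overlap guaranteed with a stabilizer state inside the stabilizer code of [v],
   whenever this code has at most [r] logical qubits. *)
Definition overlap_bound n (r : nat) (c : R) : Prop :=
  forall v : 'cV[C]_(2 ^ n), v != 0 -> (2 ^ n <= 2 ^ r * #|stabl v|)%N ->
  exists phi, [/\ stab_vec phi,
    {in stabl v, forall t, pm R t *m phi = (sgn v t)%:C *: phi}
    & c * nrm2 v <= normsq (dot v phi)].

(** The stabilizer is already maximal, so [v] itself, normalized, is the stabilizer state. *)
Lemma overlap_bound0 n : overlap_bound n 0 1.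
Proof.
move=> v v0; rewrite mul1n => cv.
have N0 : 0 < nrm2 v by rewrite nrm2_gt0.
pose a : R := (Num.sqrt (nrm2 v))^-1.
have a2 : a * a * nrm2 v = 1.
  rewrite /a -invfM -expr2 sqr_sqrtr ?mulVf ?gt_eqF // ltW //.
have u : nrm2 (a%:C *: v) = 1.
  by apply: complexI; rewrite -dotvv dotZl dotZr dotvv conjc_real mulrA -!rmorphM /= a2.
have av0 : a%:C *: v != 0 by rewrite -nrm2_gt0 u.
have ev : {in stabl v, forall t, pm R t *m (a%:C *: v) = (sgn v t)%:C *: (a%:C *: v)}.
  by move=> t /stablP e; rewrite -scalemxAr e !scalerA mulrC.
exists (a%:C *: v); split=> //.
  apply/stab_vecP; split=> //; apply/eqP; rewrite eqn_leq card_stabl //=.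
  apply: (leq_trans cv); apply/subset_leq_card/fintype.subsetP => t tv.
  by case: (stabl_eig av0 (ev t tv)).
rewrite mul1r dotZr dotvv -rmorphM normsqR expr2 mulrACA mulrA a2 mul1r //.
Qed.

(** Conjugation by P_l negates P_t but preserves the expectation, [v] being an eigenvector with
    eigenvalue of modulus 1. *)
Lemma ev_anticomm n (v : 'cV[C]_(2 ^ n)) t l :
  l \in stabl v -> sg R t l != 1 -> ev v t = 0.
Proof.
move=> lv n1; apply/eqP; have e := stablP lv.
have : ev v t = sg R l t * ev v t.
  apply: complexI; rewrite rmorphM /= -!evE.
  transitivity (dot (pm R l *m v) (pm R t *m (pm R l *m v))).
    rewrite e -scalemxAr dotZl dotZr conjc_real mulrA -rmorphM sgn_sq mul1r //.
  rewrite dot_mulmxl pm_adj !mulmxA pm_comm -!scalemxAl dotZr; congr (_ * dot _ _).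
  by rewrite -(mulmxA (pm R t)) pmK mulmx1.
move/eqP; rewrite -subr_eq0 -[X in X - _]mul1r -mulrBl mulf_eq0 subr_eq0 eq_sym.
by rewrite sgC (negPf n1).
Qed.

(* The [4^n / |L|] labels commuting with [L = stabl v] carry all of
   [\sum_t <P_t>^2 = 2^n |v|^4], of which [L] itself accounts for [|L| |v|^4];
   the condition on [b] compares with the average over the remaining ones. *)
Lemma exists_logical n (v : 'cV[C]_(2 ^ n)) (r : nat) (b : R) :
  v != 0 -> (0 < r)%N -> (2 ^ n = 2 ^ r * #|stabl v|)%N ->
  b ^+ 2 * ((2 ^ r)%:R + 1) < 1 ->
  exists2 t, (t \notin stabl v) && [forall l in stabl v, sg R t l == 1]
    & b ^+ 2 * nrm2 v ^+ 2 <= ev v t ^+ 2.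
Proof.
move=> v0 r0 En hb; set L := stabl v; pose K := [set t | [forall l in L, sg R t l == 1]].
have gL := stabl_lgrp v0.
case: (boolP [exists t, (t \in K :\: L) && (b ^+ 2 * nrm2 v ^+ 2 <= ev v t ^+ 2)]).
  move=> /existsP[t /andP[]]; rewrite finset.in_setD => /andP[tL tK] h; exists t => //.
  by rewrite tL; move: tK; rewrite inE.
rewrite negb_exists => /forallP h; exfalso.
have N0 : 0 < nrm2 v ^+ 2 by rewrite exprn_gt0 // nrm2_gt0.
have LK : L \subset K.
  apply/fintype.subsetP => t tL; rewrite inE; apply/forallP => l; apply/implyP => lL.
  by rewrite (srep_sg (stabl_srep v0)).
have cK : #|K :\: L|%:R = #|K|%:R - #|L|%:R :> R.
  by rewrite cardsD (finset.setIidPr LK) natrB // subset_leq_card.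
have : (2 ^ n)%:R * nrm2 v ^+ 2 <= #|L|%:R * nrm2 v ^+ 2
    + (#|K|%:R - #|L|%:R) * (b ^+ 2 * nrm2 v ^+ 2).
  rewrite -sum_ev_sq (bigID (mem L)) /=; apply: lerD.
    rewrite (eq_bigr (fun=> nrm2 v ^+ 2)) => [|t tv]; last first.
      by rewrite ev_stabl // exprMn expr2 sgn_sq mul1r.
    by rewrite sumr_const mulr_natl.
  rewrite -cK mulr_natl -sumr_const [X in _ <= X]big_mkcond [X in X <= _]big_mkcond /=.
  apply: ler_sum => t _; rewrite finset.in_setD; case: (boolP (t \in L)) => //= tL.
  have := h t; rewrite finset.in_setD tL /=; case: (boolP (t \in K)) => //= tK.
    by rewrite -ltNge => /ltW.
  move=> _; move: tK; rewrite inE negb_forall => /existsP[l].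
  by rewrite negb_imply => /andP[lL /(ev_anticomm lL) ->]; rewrite expr0n.
have EnR : (2 ^ n)%:R = (2 ^ r)%:R * #|L|%:R :> R by rewrite -natrM -En.
have := card_commutant gL; rewrite natrM -/K EnR.
have L0 : (0 : R) < #|L|%:R by rewrite ltr0n card_gt0; apply/set0Pn; exists 0; case: gL.
have X1 : (1 : R) < (2 ^ r)%:R by rewrite ltr1n; apply: (@leq_trans (2 ^ 1)%N); rewrite ?leq_exp2l.
move: hb L0 X1; rewrite -/L.
set X := (2 ^ r)%:R; set D := #|L|%:R; set k := #|K|%:R => hb D0 X1 kD.
have -> : k = X ^+ 2 * D.
  by apply: (mulIf (lt0r_neq0 D0)); rewrite kD; ring.
(* The inequality reads X D <= D + (X^2 - 1) D b^2 up to |v|^4; dividing by D (X - 1) shows where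
   the threshold b^2 (2^r + 1) = 1 comes from. *)
move=> h2; have : D * (X - 1) * (1 - b ^+ 2 * (X + 1)) * nrm2 v ^+ 2 <= 0.
  by rewrite -subr_le0 in h2; apply: le_trans h2; rewrite le_eqVlt; apply/orP; left; apply/eqP; ring.
by rewrite pmulr_lle0 // leNgt mulr_gt0 // ?subr_gt0 // mulr_gt0 // subr_gt0.
Qed.

(** Projecting onto the likelier outcome [e] of the Pauli string from [exists_logical] doubles the
    stabilizer and retains at least the fraction (1 + b) / 2 of the weight. *)
Lemma overlap_boundS n r (b c : R) : 0 <= c -> 0 <= b <= 1 ->
  b ^+ 2 * ((2 ^ r.+1)%:R + 1) < 1 ->
  overlap_bound n r c -> overlap_bound n r.+1 (c * ((1 + b) / 2%:R)).
Proof.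
move=> c0 /andP[b0 b1] hb IH v v0 hv.
have N0 := nrm2_ge0 v.
have [small|big] := leqP (2 ^ n) (2 ^ r * #|stabl v|).
  have [phi [p1 p2 p3]] := IH v v0 small; exists phi; split=> //.
  apply: le_trans p3; rewrite ler_wpM2r // ler_piMr // ler_pdivrMr ?ltr0n //.
  by rewrite mul1r; lra.
have En : (2 ^ n = 2 ^ r.+1 * #|stabl v|)%N.
  have [j ej] := lgrp_card (stabl_lgrp v0); move: hv big; rewrite ej -!expnD.
  rewrite leq_exp2l // ltn_exp2l // => h1 h2; congr (2 ^ _)%N.
  by apply/eqP; rewrite eqn_leq h1.
have [t /andP[tv /forallP tc] ht] := exists_logical v0 (ltn0Sn r) En hb.
pose e : R := if 0 <= ev v t then 1 else -1.
have e2 : e * e = 1 by rewrite /e; case: ifP; rewrite ?mulrNN mulr1.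
have he : b * nrm2 v <= e * ev v t.
  have -> : e * ev v t = `|ev v t|.
    rewrite /e; case: lerP => h; first by rewrite mul1r ger0_norm.
    by rewrite mulN1r ltr0_norm.
  rewrite -ler_sqr ?nnegrE ?mulr_ge0 // exprMn.
  by rewrite real_normK // num_real.
pose w := (2%:R^-1 : R)%:C *: (v + e%:C *: (pm R t *m v)).
have Pt : pm R t *m w = e%:C *: w.
  rewrite /w -scalemxAr scalerA mulrC -scalerA; congr (_ *: _).
  by rewrite mulmxDr -scalemxAr mulmxA pmK mul1mx scalerDr scalerA -rmorphM e2 scale1r addrC.
have Pl l : l \in stabl v -> pm R l *m w = (sgn v l)%:C *: w.
  move=> lv; have el := stablP lv; have /eqP sl := implyP (tc l) lv.
  rewrite /w -scalemxAr scalerA mulrC -scalerA; congr (_ *: _).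
  rewrite mulmxDr -scalemxAr mulmxA pm_comm sgC sl scale1r -mulmxA el -scalemxAr.
  by rewrite scalerDr !scalerA; congr (_ + _ *: _); rewrite mulrC.
have Nw : nrm2 w = (nrm2 v + e * ev v t) / 2%:R.
  have Pv : dot (pm R t *m v) (pm R t *m v) = (nrm2 v)%:C.
    by rewrite dot_mulmxl pm_adj mulmxA pmK mul1mx dotvv.
  have Pv' : dot (pm R t *m v) v = (ev v t)%:C by rewrite dot_mulmxl pm_adj evE.
  apply: complexI; rewrite -dotvv /w dotZl dotZr conjc_real dotDl !dotDr !dotZl !dotZr.
  rewrite conjc_real Pv Pv' evE dotvv -!(rmorphM, rmorphD) /=; congr (_%:C).
  transitivity ((nrm2 v + e * e * nrm2 v + 2%:R * (e * ev v t)) / (2%:R * 2%:R)); first by field.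
  by rewrite e2; field.
have Nw' : (1 + b) / 2%:R * nrm2 v <= nrm2 w.
  by rewrite Nw mulrAC ler_pM2r ?invr_gt0 ?ltr0n // mulrDl mul1r lerD2l.
have w0 : w != 0.
  rewrite -nrm2_gt0; apply: lt_le_trans Nw'; rewrite mulr_gt0 ?nrm2_gt0 // divr_gt0 ?ltr0n //.
  lra.
have Ll l : l \in stabl v -> l \in stabl w by move=> lv; case: (stabl_eig w0 (Pl l lv)).
have tw : t \in stabl w by case: (stabl_eig w0 Pt).
have gw := stabl_lgrp w0; have gv := stabl_lgrp v0.
(* The coset of [t] is disjoint from [stabl v] because [t] lies outside, and both stabilize [w]. *)
have cw : (2 * #|stabl v| <= #|stabl w|)%N.
  have dis : [disjoint stabl v & [set t + l | l in stabl v]].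
    rewrite finset.disjoints_subset; apply/fintype.subsetP => x xv; rewrite inE.
    apply: contra tv => /imsetP[l lv xe].
    by rewrite -[t](addrK l) -xe labN; case: gv => _; apply.
  have := subset_leq_card (A := mem (stabl v :|: [set t + l | l in stabl v])) (B := mem (stabl w)).
  rewrite cardsU (finset.disjoint_setI0 dis) cards0 subn0 card_imset; last exact: addrI.
  rewrite addnn -mul2n; apply; apply/fintype.subsetP => x; rewrite inE => /orP[/Ll//|/imsetP[l lv ->]].
  by case: gw => _; apply=> //; apply: Ll.
have hw : (2 ^ n <= 2 ^ r * #|stabl w|)%N.
  by apply: (leq_trans hv); rewrite expnS mulnAC mulnC leq_mul.
have [phi [p1 p2 p3]] := IH w w0 hw.
exists phi; split=> //.
  move=> l lv; rewrite p2 ?Ll //.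
  by have [_ /complexI ->] := stabl_eig w0 (Pl l lv).
(* [phi] lies in the eigenspace onto which [v] was projected. *)
have -> : dot v phi = dot w phi.
  have pt : pm R t *m phi = e%:C *: phi.
    by rewrite p2 //; have [_ /complexI <-] := stabl_eig w0 Pt.
  rewrite /w dotZl conjc_real dotDl dotZl conjc_real dot_mulmxl pm_adj pt dotZr mulrA.
  have h2 : (2%:R^-1 : R)%:C + (2%:R^-1)%:C = 1 :> C.
    by rewrite -rmorphD -(rmorph1 (real_complex R)) /=; congr (_%:C); field.
  by rewrite -rmorphM e2 mul1r mulrDr -mulrDl h2 mul1r.
by apply: le_trans p3; rewrite -mulrA ler_wpM2l.
Qed.

(* The factors [(1 + b_r) / 2] with [b_r] slightly below [1 / sqrt (2^r + 1)] have product
   at least [2^(- r / 2)] up to [r = 3]; this fails for [r = 4]. *)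
Lemma overlap_bound_le3 n r : (r <= 3)%N ->
  exists c : R, [/\ 0 < c, 1 <= c ^+ 2 * (2 ^ r)%:R & overlap_bound n r c].
Proof.
(* The values 1/2, 11/25, 8/25 lie below 1/sqrt 3, 1/sqrt 5, 1/3. Room is scarce only at the end,
   where 8 d3^2 is about 1.016. *)
pose d1 : R := 1 * ((1 + 1 / 2%:R) / 2%:R).
pose d2 : R := d1 * ((1 + 11%:R / 25%:R) / 2%:R).
pose d3 : R := d2 * ((1 + 8%:R / 25%:R) / 2%:R).
have h1 : overlap_bound n 1 d1.
  by apply: overlap_boundS (@overlap_bound0 n); rewrite ?expn1; lra.
have h2 : overlap_bound n 2 d2.
  by apply: overlap_boundS h1; rewrite /d1 ?[(2 ^ 2)%N]/4; lra.
have h3 : overlap_bound n 3 d3.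
  by apply: overlap_boundS h2; rewrite /d2 /d1 ?[(2 ^ 3)%N]/8; lra.
case: r => [|[|[|[|//]]]] _.
- by exists 1; split; [lra | rewrite expr1n mulr1 | exact: overlap_bound0].
- by exists d1; split=> //; rewrite /d1 ?expn1; lra.
- by exists d2; split=> //; rewrite /d2 /d1 ?[(2 ^ 2)%N]/4; lra.
- by exists d3; split=> //; rewrite /d3 /d2 /d1 ?[(2 ^ 3)%N]/8; lra.
Qed.

(** * Projection onto a stabilizer code *)

Section CodeProjection.
Variables (n : nat) (L : {set lab n}) (s : lab n -> R) (v : 'cV[C]_(2 ^ n)).
Hypotheses (gL : lgrp L) (rL : srep L id s).
(** This is |L| times the projection of [v] onto the code. *)
Let w := \sum_(l in L) (s l)%:C *: (pm R l *m v).
Let E := \sum_(l in L) s l * ev v l.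

Lemma code_nrm2 : nrm2 w = #|L|%:R * E.
Proof. exact: (@srep_nrm2 R n n L id s gL rL). Qed.

Lemma code_eigen l : l \in L -> pm R l *m w = (s l)%:C *: w.
Proof.
move=> lL; rewrite /w mulmx_sumr scaler_sumr -[RHS](lgrp_sum _ gL lL).
apply: eq_bigr => k kL; have [_ sM] := rL.
rewrite -scalemxAr mulmxA pmM -scalemxAl !scalerA -sM // rmorphM /=; congr (_ *: _).
rewrite !mulrA -rmorphM (srep_sq rL lL) mul1r //.
Qed.

Lemma dot_code phi : {in L, forall l, pm R l *m phi = (s l)%:C *: phi} ->
  dot w phi = #|L|%:R * dot v phi.
Proof.
move=> ephi; rewrite /w dot_suml mulr_natl -sumr_const; apply: eq_bigr => l lL.
rewrite dotZl conjc_real dot_mulmxl pm_adj ephi // dotZr mulrA -rmorphM.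
by rewrite (srep_sq rL lL) mul1r.
Qed.
End CodeProjection.

Lemma normsq_natM k (z : C) : normsq (k%:R * z) = k%:R ^+ 2 * normsq z.
Proof. by rewrite -(rmorph_nat (real_complex R)) normsqM normsqR. Qed.

Lemma lgrp_card_gt0 n (L : {set lab n}) : lgrp L -> (0 : R) < #|L|%:R.
Proof. by case=> L0 _; rewrite ltr0n card_gt0; apply/set0Pn; exists 0. Qed.

(** Alignment is applied to the full group of [phi], where |L| = 2^n turns the root into |L|;
    Cauchy-Schwarz between the projected vector and [phi] bounds the overlap by the weight of the
    code. *)
Lemma aligned_stab n (v : 'cV[C]_(2 ^ n)) F phi :
  aligned v F -> stab_vec phi -> normsq (dot v phi) <= F.
Proof.
move=> aF /stab_vecP[N1 c1].
have phi0 : phi != 0 by rewrite -nrm2_gt0 N1.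
have gL := stabl_lgrp phi0; have rL := stabl_srep phi0.
have D0 := lgrp_card_gt0 gL.
have := cauchy_schwarz (\sum_(l in stabl phi) (sgn phi l)%:C *: (pm R l *m v)) phi.
rewrite (dot_code _ rL) ?code_nrm2 // => [|l /stablP //].
rewrite N1 mulr1 normsq_natM expr2 -mulrA ler_pM2l // => h.
have := le_trans h (aF _ _ gL rL).
have c1R : (2 ^ n)%:R = #|stabl phi|%:R :> R by rewrite c1.
by rewrite c1R -expr2 sqrtr_sqr ger0_norm ?ler0n // ler_pM2l.
Qed.

Lemma stab_fid_ub n (psi : 'cV[C]_(2 ^ n)) phi : unit_vec psi -> stab_vec phi ->
  normsq (dot psi phi) <= stab_fid psi.
Proof.
move=> /unit_vecE u hphi; apply: ub_le_sup; last by exists phi.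
exists 1 => _ [chi [/stab_vecP[c1 _] ->]].
by have := cauchy_schwarz psi chi; rewrite u c1 mulr1.
Qed.

(** For |L| = 2^j the projection of [psi] onto the code has at most q - j logical qubits left. The
    stabilizer state found inside the code gives c E <= |L| F, and c sqrt(2^(q - j)) >= 1 removes
    [c]. *)
Lemma aligned_stab_fid q (psi : 'cV[C]_(2 ^ q)) : (q <= 3)%N -> unit_vec psi ->
  aligned psi (stab_fid psi).
Proof.
move=> q3 u L s gL rL; set E := \sum_(l in L) _.
have D0 := lgrp_card_gt0 gL.
pose w := \sum_(l in L) (s l)%:C *: (pm R l *m psi).
have Nw : nrm2 w = #|L|%:R * E by apply: code_nrm2.
have [w0|w0] := eqVneq w 0.
  have E0 : E = 0.
    apply/eqP; have /eqP := Nw; rewrite w0 /nrm2 /dot mulmx0 mxE eq_sym mulf_eq0.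
    by rewrite gt_eqF.
  (* Nonnegativity of the supremum requires a stabilizer state to exist; the overlap bound for [psi]
     itself supplies one. *)
  have F0 : 0 <= stab_fid psi.
    have psi0 := unit_vec_neq0 u.
    have [c [_ _ /(_ psi psi0)]] := overlap_bound_le3 q q3.
    rewrite leq_pmulr => [/(_ isT)[phi [p1 _ _]]|]; last first.
      by rewrite -(ltr0n R); apply/lgrp_card_gt0/stabl_lgrp.
    by apply: le_trans (stab_fid_ub u p1); exact: normsq_ge0.
  by rewrite E0 mulr_ge0 ?sqrtr_ge0.
have sub : L \subset stabl w.
  by apply/fintype.subsetP => l lL; case: (stabl_eig w0 (code_eigen psi gL rL lL)).
have [j ej] := lgrp_card gL.
have jq : (j <= q)%N.
  have := leq_trans (subset_leq_card sub) (card_stabl w0).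
  by rewrite ej leq_exp2l.
have [c [c0 c2 hc]] := overlap_bound_le3 q (leq_trans (leq_subr j q) q3).
have e2 : (2 ^ q = 2 ^ (q - j) * #|L|)%N by rewrite ej -expnD subnK.
have hw : (2 ^ q <= 2 ^ (q - j) * #|stabl w|)%N.
  by rewrite {1}e2 leq_mul // subset_leq_card.
have [phi [p1 p2 p3]] := hc w w0 hw.
have ephi : {in L, forall l, pm R l *m phi = (s l)%:C *: phi}.
  move=> l lL; rewrite p2 ?(fintype.subsetP sub) //.
  by have [_ /complexI ->] := stabl_eig w0 (code_eigen psi gL rL lL).
move: p3; rewrite (dot_code psi rL ephi) Nw normsq_natM.
have F1 := stab_fid_ub u p1; set F := stab_fid psi in F1 *.
rewrite expr2 -mulrA mulrCA ler_pM2l // => p3.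
have F0 : 0 <= F by apply: le_trans F1; exact: normsq_ge0.
have cE : c * E <= #|L|%:R * F by apply: (le_trans p3); rewrite ler_pM2l.
rewrite -(ler_pM2l c0); apply: (le_trans cE); rewrite mulrA ler_wpM2r //.
have -> : (2 ^ q)%:R * #|L|%:R = (2 ^ (q - j))%:R * #|L|%:R ^+ 2 :> R.
  by rewrite {1}e2 natrM expr2 mulrA.
have c1 : 1 <= c * Num.sqrt (2 ^ (q - j))%:R.
  rewrite -ler_sqr ?nnegrE ?mulr_ge0 ?sqrtr_ge0 // ?(ltW c0) //.
  by rewrite expr1n exprMn sqr_sqrtr ?ler0n.
by rewrite sqrtrM ?ler0n // sqrtr_sqr ger0_norm ?ler0n // mulrA ler_peMl ?ler0n.
Qed.

(** Alignment for the trivial group reads 1 <= sqrt(2^q) F. *)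
Lemma stab_fid_gt0 q (psi : 'cV[C]_(2 ^ q)) : (q <= 3)%N -> unit_vec psi ->
  0 < stab_fid psi.
Proof.
move=> q3 u; have a := aligned_stab_fid q3 u.
have F0 := aligned_ge0 a; rewrite lt_def F0 andbT; apply/eqP => h.
have := aligned_nrm2 a; rewrite h mulr0.
by move/unit_vecE: u => ->; rewrite ler10.
Qed.

Lemma aligned_castmx a b (e : a = b) (v : 'cV[C]_(2 ^ a)) F :
  aligned v F -> aligned (castmx (congr1 (expn 2) e, erefl) v) F.
Proof. by case: b / e. Qed.

(** The first power is [v] itself, without a trivial tensor factor, so inductions on powers start at
    one copy. *)
Lemma vtpow1 n (v : 'cV[C]_(2 ^ n)) :
  vtpow v 1 = castmx (congr1 (expn 2) (esym (muln1 n)), erefl) v.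
Proof. exact: castmx_irr. Qed.

Lemma vtpowSS n (v : 'cV[C]_(2 ^ n)) m :
  vtpow v m.+2 = castmx (congr1 (expn 2) (esym (mulnS n m.+1)), erefl) (vtens v (vtpow v m.+1)).
Proof.
rewrite /vtens /vtpow.
have e1 : (2 ^ n * (2 ^ n) ^ m.+1 = 2 ^ n * 2 ^ (n * m.+1))%N by rewrite -expnM.
have e2 : (1 * 1 ^ m.+1 = 1 * 1)%N by rewrite exp1n.
rewrite (tens_castr _ _ e1 e2) ntensmxSS !castmx_comp.
exact: castmx_irr.
Qed.

Lemma aligned_vtpow q (psi : 'cV[C]_(2 ^ q)) F m :
  aligned psi F -> aligned (vtpow psi m.+1) (F ^+ m.+1).
Proof.
move=> aF; elim: m => [|m IH]; first by rewrite vtpow1 expr1; apply: aligned_castmx.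
by rewrite vtpowSS exprS; apply/aligned_castmx/aligned_vtens.
Qed.

Lemma stab_fid_vtpow q (psi : 'cV[C]_(2 ^ q)) m phi : (q <= 3)%N -> unit_vec psi ->
  (0 < m)%N -> stab_vec phi -> normsq (dot (vtpow psi m) phi) <= stab_fid psi ^+ m.
Proof.
move=> q3 u; case: m phi => // m phi _ hphi.
exact: aligned_stab (aligned_vtpow (aligned_stab_fid q3 u)) hphi.
Qed.
End Fidelity.

(** * Positive semidefinite matrices *)

Section Psd.
Variable R : realType.
Local Notation C := R[i].

Lemma psdE N (A : 'M[C]_N) : psd A <-> forall x, 0 <= dot x (A *m x).
Proof. by split=> h x; have := h x; rewrite -expectE. Qed.

Lemma psdD N (A B : 'M[C]_N) : psd A -> psd B -> psd (A + B).
Proof.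
by move=> /psdE hA /psdE hB; apply/psdE => x; rewrite mulmxDl dotDr addr_ge0.
Qed.

Lemma psdZ N a (A : 'M[C]_N) : 0 <= a -> psd A -> psd (a *: A).
Proof.
by move=> a0 /psdE hA; apply/psdE => x; rewrite -scalemxAl dotZr mulr_ge0.
Qed.

Lemma psd_sum N (I : Type) (r : seq I) (P : pred I) (F : I -> 'M[C]_N) :
  (forall i, P i -> psd (F i)) -> psd (\sum_(i <- r | P i) F i).
Proof.
move=> h; elim/big_ind: _ => //; last exact: psdD.
by apply/psdE => x; rewrite mul0mx /dot mulmx0 mxE.
Qed.

Lemma dot_proj N (v x : 'cV[C]_N) : dot x (Defs.proj v *m x) = (normsq (dot x v))%:C.
Proof.
rewrite normsqE -dotC -mulmxA [adj v *m x]mx11_scalar mul_mx_scalar dotZr mulrC.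
by [].
Qed.

Lemma psd_proj N (v : 'cV[C]_N) : psd (Defs.proj v).
Proof. by apply/psdE => x; rewrite dot_proj ler0c normsq_ge0. Qed.

(** The difference of the adjoint and [A] has zero quadratic form, since that of [A] is real;
    polarization with y and 'i y then makes its sesquilinear form vanish. *)
Lemma psd_adj N (A : 'M[C]_N) : psd A -> adj A = A.
Proof.
move=> /psdE hA; pose D := adj A - A.
have D0 x : dot x (D *m x) = 0.
  rewrite mulmxBl -scaleN1r dotDr dotZr mulN1r -dot_mulmxl dotC.
  have /RRe_real <- : dot x (A *m x) \is Num.real by apply: ger0_real.
  by rewrite conjc_real subrr.
have D1 x y : dot x (D *m y) + dot y (D *m x) = 0.
  by have := D0 (x + y); rewrite mulmxDr dotDl !dotDr !D0 add0r addr0.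
have D2 x y : dot x (D *m y) = 0.
  have := D1 x ('i *: y); rewrite -scalemxAr dotZr dotZl => h.
  have : 2%:R * 'i * dot x (D *m y) = 'i * (dot x (D *m y) + dot y (D *m x)) +
     ('i * dot x (D *m y) + conjc 'i * dot y (D *m x)).
    have -> : conjc ('i : C) = - 'i by apply: complex_eq; rewrite /= ?oppr0.
    by ring.
  rewrite h D1 mulr0 addr0 => /eqP; rewrite !mulf_eq0 pnatr_eq0 /= => /orP[|/eqP //].
  by rewrite eq_complex /= oner_eq0 andbF.
apply/eqP; rewrite -subr_eq0 -/D; apply/eqP/matrixP => i j.
have := D2 (delta_mx i 0) (delta_mx j 0).
rewrite mxE -colE dotE (bigD1 i) //= !mxE !eqxx conjc_nat /= mul1r big1 ?addr0 //.
by move=> k ki; rewrite !mxE conjc_nat (negPf ki) /= mul0r.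
Qed.

(** By the spectral theorem: eigenvectors scaled by the roots of their eigenvalues. *)
Lemma psd_decomp N (A : 'M[C]_N) : psd A ->
  exists F : 'I_N -> 'cV[C]_N, A = \sum_i Defs.proj (F i).
Proof.
move=> hA; have aA := psd_adj hA; move/psdE: hA => hA.
have nA : A \is normalmx.
  by apply/normalmxP; change (A *m adj A = adj A *m A); rewrite aA.
have /orthomx_spectralP eA := nA.
set P := spectralmx A in eA; set d := spectral_diag A in eA.
have uP : P \is unitarymx by apply: spectral_unitarymx.
have eP : invmx P = adj P by rewrite invmx_unitary.
have PP : P *m adj P = 1%:M by rewrite -eP mulmxV // spectral_unit.
rewrite eP in eA.
have d0 j : 0 <= d 0 j.
  have := hA (adj P *m delta_mx j 0); rewrite dot_mulmxl adjK {1}eA.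
  have K (u : 'cV[C]_N) : P *m (adj P *m u) = u by rewrite mulmxA PP mul1mx.
  rewrite -!mulmxA !K.
  rewrite -colE dotE (bigD1 j) //= big1 ?addr0 => [|k kj]; last first.
    by rewrite !mxE conjc_nat (negPf kj) /= mul0r.
  by rewrite !mxE !eqxx conjc_nat /= mul1r mulr1n.
exists (fun j => sqrtc (d 0 j) *: (adj P *m delta_mx j 0)).
rewrite {1}eA; apply/matrixP => i k; rewrite summxE mul_mx_diag mxE.
apply: eq_bigr => j _.
rewrite /Defs.proj adjZ adjM adjK -scalemxAl -scalemxAr scalerA -colE mxE.
have -> : sqrtc (d 0 j) * conjc (sqrtc (d 0 j)) = d 0 j.
  have /RRe_real <- : sqrtc (d 0 j) \is Num.real by rewrite ger0_real ?sqrtc_ge0.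
  rewrite conjc_real /= -rmorphM -expr2.
  have h : sqrtc (d 0 j) \is Num.real by rewrite ger0_real ?sqrtc_ge0.
  by rewrite rmorphXn /= (RRe_real h) sqr_sqrtc.
rewrite !mxE big_ord1 mxE [X in _ = _ * (_ * X)]mxE (bigD1 j) //= big1 ?addr0.
  by rewrite !mxE eqxx conjc_nat /= mul1r mulrCA mulrA.
by move=> l lj; rewrite !mxE conjc_nat (negPf lj) /= mul0r.
Qed.

Lemma psd_tens M N (A : 'M[C]_M) (B : 'M[C]_N) : psd A -> psd B -> psd (A *t B).
Proof.
move=> /psd_decomp[F ->] /psd_decomp[G ->].
have -> : (\sum_i Defs.proj (F i)) *t (\sum_j Defs.proj (G j)) =
    \sum_i \sum_j Defs.proj (F i *t G j : 'cV_(M * N)).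
  apply/matrixP => x y; rewrite mxE !summxE big_distrlr /=; apply: eq_bigr => i _.
  rewrite summxE; apply: eq_bigr => j _.
  have -> : Defs.proj (F i *t G j : 'cV_(M * N)) = Defs.proj (F i) *t Defs.proj (G j).
    exact: etrans (congr1 (fun X => (F i *t G j) *m X) (adj_tens _ _)) (tensmx_mul _ _ _ _).
  by rewrite [RHS]mxE.
by apply: psd_sum => i _; apply: psd_sum => j _; apply: psd_proj.
Qed.

Lemma psd_tr N (A : 'M[C]_N) : psd A -> 0 <= \tr A.
Proof.
move=> /psd_decomp[F ->]; rewrite raddf_sum /= sumr_ge0 // => i _.
by rewrite /Defs.proj mxtrace_mulC /mxtrace big_ord1 -/(dot _ _) dot_ge0.
Qed.

Lemma psd_castmx M N (e : M = N) (A : 'M[C]_M) : psd A -> psd (castmx (e, e) A).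
Proof. by case: N / e. Qed.

(** Complete positivity with an ancilla of dimension 1. *)
Lemma cp_positive a b (O : 'M[C]_(2 ^ a) -> 'M[C]_(2 ^ b)) X :
  completely_positive O -> psd X -> psd (O X).
Proof.
move=> cpO hX.
have h1 : psd (1%:M : 'M[C]_1) by apply/psdE => x; rewrite mul1mx dot_ge0.
have := cpO 1%N _ (psd_tens h1 hX); rewrite /id_tens !big_ord1.
have -> : blk ((1%:M : 'M[C]_1) *t X) ord0 ord0 = X.
  by apply/matrixP => i j; rewrite mxE tensmxE !mxE mul1r.
move=> /psdE h; apply/psdE => x.
have := h ((1%:M : 'cV[C]_1) *t x : 'cV_(1 * 2 ^ b)).
rewrite [_ *t _ *m _](tensmx_mul _ _ (1%:M : 'cV[C]_1) x) dot_tens.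
by rewrite /dot adj1 mul1mx mulmx1 [delta_mx _ _ _ _]mxE eqxx mul1r.
Qed.
End Psd.

(** * Tensor powers *)

Section TensorPower.
Variable R : realType.
Local Notation C := R[i].

Definition mtens a b (A : 'M[C]_(2 ^ a)) (B : 'M[C]_(2 ^ b)) : 'M[C]_(2 ^ (a + b)) :=
  castmx (esym (expnD 2 a b), esym (expnD 2 a b)) (A *t B).

Lemma mtensDl a b (A A' : 'M[C]_(2 ^ a)) (B : 'M[C]_(2 ^ b)) :
  mtens (A + A') B = mtens A B + mtens A' B.
Proof.
rewrite /mtens -castmxD; congr castmx.
by apply/matrixP => i j; rewrite !mxE mulrDl.
Qed.

Lemma mtensDr a b (A : 'M[C]_(2 ^ a)) (B B' : 'M[C]_(2 ^ b)) :
  mtens A (B + B') = mtens A B + mtens A B'.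
Proof.
rewrite /mtens -castmxD; congr castmx.
by apply/matrixP => i j; rewrite !mxE mulrDr.
Qed.

Lemma mtensZ a b x y (A : 'M[C]_(2 ^ a)) (B : 'M[C]_(2 ^ b)) :
  mtens (x *: A) (y *: B) = (x * y) *: mtens A B.
Proof. by rewrite /mtens tensmxZ castmxZ. Qed.

Lemma psd_mtens a b (A : 'M[C]_(2 ^ a)) (B : 'M[C]_(2 ^ b)) :
  psd A -> psd B -> psd (mtens A B).
Proof. by move=> hA hB; apply/psd_castmx/psd_tens. Qed.

Lemma mxtrace_mtens a b (A : 'M[C]_(2 ^ a)) (B : 'M[C]_(2 ^ b)) :
  \tr (mtens A B) = \tr A * \tr B.
Proof. by rewrite mxtrace_castmx mxtrace_tens. Qed.

Lemma proj_vtens a b (u : 'cV[C]_(2 ^ a)) (v : 'cV[C]_(2 ^ b)) :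
  Defs.proj (vtens u v) = mtens (Defs.proj u) (Defs.proj v).
Proof.
have e : Defs.proj (u *t v : 'cV_(2 ^ a * 2 ^ b)) = Defs.proj u *t Defs.proj v.
  exact: etrans (congr1 (fun X => (u *t v) *m X) (adj_tens _ _)) (tensmx_mul _ _ _ _).
rewrite /mtens -e /vtens.
by move: (u *t v : 'cV_(2 ^ a * 2 ^ b)) => w; case: (2 ^ (a + b))%N / (esym _).
Qed.

Lemma vtensZ a b x y (u : 'cV[C]_(2 ^ a)) (v : 'cV[C]_(2 ^ b)) :
  vtens (x *: u) (y *: v) = (x * y) *: vtens u v.
Proof.
rewrite /vtens -castmxZ; congr castmx.
by apply/matrixP => i j; rewrite !mxE mulrACA.
Qed.

(** The concatenated labels already number 2^a 2^b, the maximum permitted by [card_stabl]. *)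
Lemma stab_vec_vtens a b (u : 'cV[C]_(2 ^ a)) (v : 'cV[C]_(2 ^ b)) :
  stab_vec u -> stab_vec v -> stab_vec (vtens u v).
Proof.
move=> /stab_vecP[u1 cu] /stab_vecP[v1 cv].
have w1 : nrm2 (vtens u v) = 1.
  by apply: complexI; rewrite -dotvv dot_vtens !dotvv u1 v1 mulr1.
have w0 : vtens u v != 0 by rewrite -nrm2_gt0 w1.
apply/stab_vecP; split=> //; apply/eqP; rewrite eqn_leq card_stabl //=.
rewrite expnD -cu -cv -cardsX.
rewrite -(card_imset _ (f := fun x => lcat x.1 x.2)); last first.
  move=> [t t'] [s s'] /= e.
  have [e1 e2] := (congr1 (@lfst a b) e, congr1 (@lsnd a b) e).
  by move: e1 e2; rewrite !(lcatK _ _).1 !(lcatK _ _).2 => -> ->.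
apply/subset_leq_card/fintype.subsetP => _ /imsetP[[t t'] /= + ->].
rewrite finset.in_setX => /andP[/= /stablP et /stablP et'].
have e : pm R (lcat t t') *m vtens u v = (sgn u t * sgn v t')%:C *: vtens u v.
  by rewrite pm_vtens et et' vtensZ rmorphM.
by case: (stabl_eig w0 e).
Qed.

Lemma mixed_stab_psd n (A : 'M[C]_(2 ^ n)) : mixed_stab A -> psd A.
Proof.
move=> [s [hs [_ ->]]]; rewrite big_seq; apply: psd_sum => x /hs[x0 _].
by apply: psdZ; rewrite ?ler0c //; apply: psd_proj.
Qed.

Lemma mixed_stab_tr n (A : 'M[C]_(2 ^ n)) : mixed_stab A -> \tr A = 1.
Proof.
move=> [s [hs [s1 ->]]]; rewrite raddf_sum /= -(rmorph1 (real_complex R)) -s1 rmorph_sum /=.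
rewrite big_seq [RHS]big_seq; apply: eq_bigr => x /hs[_ /stab_vecP[x1 _]].
by rewrite mxtraceZ /Defs.proj mxtrace_mulC /mxtrace big_ord1 -/(dot _ _) dotvv x1 mulr1.
Qed.

Lemma mixed_stab_mtens a b (A : 'M[C]_(2 ^ a)) (B : 'M[C]_(2 ^ b)) :
  mixed_stab A -> mixed_stab B -> mixed_stab (mtens A B).
Proof.
move=> [s [hs [s1 ->]]] [t [ht [t1 ->]]].
exists [seq (x.1 * y.1, vtens x.2 y.2) | x <- s, y <- t]; split; last split.
- move=> _ /allpairsP[[x y] /= [/hs[x0 xs] /ht[y0 ys] ->]] /=.
  by split; [exact: mulr_ge0 | exact: stab_vec_vtens].
- rewrite big_allpairs_dep /= -[RHS]mulr1 -{1}s1 -t1 mulr_suml; apply: eq_bigr => x _.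
  by rewrite mulr_sumr.
rewrite big_allpairs_dep /=.
elim/big_rec2: _ => [|x A' S _ <-].
  by rewrite -(scale0r (0 : 'M[C]_(2 ^ a))) -[X in mtens _ X]scale1r mtensZ mul0r scale0r.
rewrite mtensDl; congr (_ + _).
elim/big_rec2: _ => [|y B' S' _ <-].
  by rewrite -[X in mtens X _]scale1r -(scale0r (0 : 'M[C]_(2 ^ b))) mtensZ mulr0 scale0r.
by rewrite mtensDr mtensZ proj_vtens -rmorphM.
Qed.

(** The cast follows an equality of qubit numbers, not of dimensions, so that predicates such as
    [mixed_stab], which depend on the number of qubits, are transported by case analysis on [e]. *)
Definition qcast a b (e : a = b) (A : 'M[C]_(2 ^ a)) : 'M[C]_(2 ^ b) :=
  castmx (congr1 (expn 2) e, congr1 (expn 2) e) A.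

Lemma qtpow1 n (A : 'M[C]_(2 ^ n)) : qtpow A 1 = qcast (esym (muln1 n)) A.
Proof. exact: castmx_irr. Qed.

Lemma qtpowSS n (A : 'M[C]_(2 ^ n)) m :
  qtpow A m.+2 = qcast (esym (mulnS n m.+1)) (mtens A (qtpow A m.+1)).
Proof.
rewrite /qcast /mtens /qtpow.
have e1 : (2 ^ n * (2 ^ n) ^ m.+1 = 2 ^ n * 2 ^ (n * m.+1))%N by rewrite -expnM.
rewrite (tens_castr _ _ e1 e1) ntensmxSS !castmx_comp.
exact: castmx_irr.
Qed.

Lemma qtpow_ind n (P : forall k, 'M[C]_(2 ^ k) -> Prop) (A : 'M[C]_(2 ^ n)) k :
  P n A -> (forall b (B : 'M[C]_(2 ^ b)), P b B -> P (n + b)%N (mtens A B)) ->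
  P (n * k.+1)%N (qtpow A k.+1).
Proof.
have castP a b (e : a = b) (B : 'M[C]_(2 ^ a)) : P a B -> P b (qcast e B).
  by case: b / e; rewrite /qcast castmx_id.
move=> PA PS; elim: k => [|k IH]; first by rewrite qtpow1; apply: castP.
by rewrite qtpowSS; apply/castP/PS.
Qed.

Lemma qtpow_mixed_stab n (A : 'M[C]_(2 ^ n)) k : mixed_stab A -> mixed_stab (qtpow A k.+1).
Proof.
by move=> hA; apply: (@qtpow_ind n (@mixed_stab R)) => // b B; apply: mixed_stab_mtens.
Qed.

Lemma qtpow_state n (A : 'M[C]_(2 ^ n)) k : is_state A -> is_state (qtpow A k.+1).
Proof.
move=> hA; apply: (@qtpow_ind n (fun k B => is_state B)) => // b B [psdB trB].
by case: hA => psdA trA; split; [exact: psd_mtens | rewrite mxtrace_mtens trA trB mulr1].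
Qed.

(** With L = l^(k+1), B and D the powers of A and S, the difference telescopes as (l S - A) x L D +
    A x (L D - B), a sum of products of positive matrices. *)
Lemma qtpow_le n (A S : 'M[C]_(2 ^ n)) (l : R) k : 0 <= l -> psd A -> psd S ->
  loewner_le A (l%:C *: S) -> loewner_le (qtpow A k.+1) ((l ^+ k.+1)%:C *: qtpow S k.+1).
Proof.
move=> l0 pA pS; rewrite /loewner_le => h.
have castB a b (e : a = b) x (B D : 'M[C]_(2 ^ a)) :
    psd (x *: B - D) -> psd (x *: qcast e B - qcast e D).
  by case: b / e; rewrite /qcast !castmx_id.
elim: k => [|k IH]; first by rewrite expr1 !qtpow1; apply: castB.
rewrite !qtpowSS; apply: castB; set L := l ^+ k.+1 in IH *.
set B := qtpow A k.+1 in IH *; set D := qtpow S k.+1 in IH *.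
have pD : psd D by apply: (@qtpow_ind n (fun k B => psd B)) => // b E; apply: psd_mtens.
have -> : (l ^+ k.+2)%:C *: mtens S D - mtens A B =
    mtens (l%:C *: S - A) (L%:C *: D) + mtens A (L%:C *: D - B).
  rewrite mtensDl mtensDr mtensZ -rmorphM -exprS.
  rewrite -[A in mtens (- A)]scale1r -scaleNr mtensZ.
  rewrite -[X in mtens X (L%:C *: D) + _]scale1r mtensZ -[X in mtens X (- B)]scale1r.
  by rewrite -[X in mtens _ (- X)]scale1r -scaleNr mtensZ !mul1r !mulN1r scaleN1r scaleNr addrA subrK.
have L0 : 0 <= L by rewrite exprn_ge0.
by apply: psdD; apply: psd_mtens => //; apply: psdZ; rewrite ?ler0c.
Qed.
End TensorPower.

(** * Distillation bounds *)

Section Distillation.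
Variable R : realType.
Local Notation C := R[i].

Lemma expectB N (v : 'cV[C]_N) (A B : 'M[C]_N) : expect v (A - B) = expect v A - expect v B.
Proof. by rewrite !expectE mulmxBl -scaleN1r dotDr dotZr mulN1r. Qed.

Lemma expectZ N (v : 'cV[C]_N) a (A : 'M[C]_N) : expect v (a *: A) = a * expect v A.
Proof. by rewrite !expectE -scalemxAl dotZr. Qed.

Lemma mixed_stab_expect q (psi : 'cV[C]_(2 ^ q)) m (sigma : 'M[C]_(2 ^ (q * m))) :
  (q <= 3)%N -> unit_vec psi -> (0 < m)%N -> mixed_stab sigma ->
  expect (vtpow psi m) sigma <= (stab_fid psi ^+ m)%:C.
Proof.
move=> q3 u m0 [s [hs [s1 ->]]]; rewrite expectE mulmx_suml dot_sumr.
rewrite -[X in _ <= X]mul1r -(rmorph1 (real_complex R)) -s1 rmorph_sum mulr_suml /=.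
rewrite big_seq [X in _ <= X]big_seq; apply: ler_sum => x /hs[x0 xs].
rewrite -scalemxAl dotZr dot_proj ler_wpM2l ?ler0c // lecR.
exact: stab_fid_vtpow.
Qed.

Lemma linear_mapB a b (O : 'M[C]_(2 ^ a) -> 'M[C]_(2 ^ b)) x (X Y : 'M[C]_(2 ^ a)) :
  linear_map O -> O (x *: X - Y) = x *: O X - O Y.
Proof.
move=> lO; have O0 : O 0 = 0.
  by have := lO (-1) 0 0; rewrite scaler0 addr0 scaleN1r addNr.
by rewrite lO -scaleN1r -[-1 *: Y]addr0 lO O0 addr0 scaleN1r.
Qed.

Section Bounds.
Variables (n q k m : nat) (rho : 'M[C]_(2 ^ n)) (psi : 'cV[C]_(2 ^ q)) (p eps : R).
Variables (O : 'M[C]_(2 ^ (n * k)) -> 'M[C]_(2 ^ (q * m))) (tau : 'M[C]_(2 ^ (q * m))).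
Hypotheses (rhoS : is_state rho) (q3 : (q <= 3)%N) (upsi : unit_vec psi).
Hypotheses (k0 : (0 < k)%N) (m0 : (0 < m)%N) (p01 : 0 < p <= 1) (hO : prob_stab_op O).
Hypotheses (tauS : is_state tau) (Orho : O (qtpow rho k) = p%:C *: tau).
Hypothesis tauF : (1 - eps)%:C <= expect (vtpow psi m) tau.

Lemma rob_ge1 (l : R) sigma : mixed_stab sigma -> loewner_le rho (l%:C *: sigma) -> 1 <= l.
Proof.
move=> hs /psd_tr; rewrite raddfB /= mxtraceZ (mixed_stab_tr hs) mulr1.
by case: rhoS => _ ->; rewrite subr_ge0 -(rmorph1 (real_complex R)) lecR.
Qed.

(* [c] is the probability that [O] succeeds on [sigma^k]; the second inequality is
   positivity of the failure branches on [l^k sigma^k - rho^k]. *)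
Lemma rob_power_bounds (l : R) sigma : mixed_stab sigma -> loewner_le rho (l%:C *: sigma) ->
  exists c : R, [/\ 0 <= c <= 1, p * (1 - eps) <= l ^+ k * c * stab_fid psi ^+ m
    & l ^+ k * c - p <= l ^+ k - 1].
Proof.
move=> hs hle; have l1 := rob_ge1 hs hle; have l0 : 0 <= l by rewrite (le_trans _ l1).
have hrho : is_state (qtpow rho k).
  by case: (k) k0 => // k' _; apply: qtpow_state.
have hS : mixed_stab (qtpow sigma k).
  by case: (k) k0 => // k' _; apply: qtpow_mixed_stab.
have hk : loewner_le (qtpow rho k) ((l ^+ k)%:C *: qtpow sigma k).
  case: (k) k0 => // k' _; apply: qtpow_le => //; first by case: rhoS.
  exact: mixed_stab_psd.
set S := qtpow sigma k in hS hk; set L := l ^+ k in hk *.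
have L0 : 0 <= L by rewrite exprn_ge0.
case: (hO) => -[lO cpO tnO spO] [Os [hOs trOs]].
(* The factor is a priori complex; as the trace of [O S] it is real and lies between 0 and 1. *)
have [c' [sigma' [hs' OS]]] := spO _ hS.
have trOS : \tr (O S) = c' by rewrite OS mxtraceZ mixed_stab_tr // mulr1.
have c0 : 0 <= c' by rewrite -trOS; apply/psd_tr/cp_positive/mixed_stab_psd.
have c1 : c' <= 1 by rewrite -trOS -(mixed_stab_tr hS); apply/tnO/mixed_stab_psd.
have [c ec] : exists c : R, c' = c%:C by apply/complex_realP; rewrite ger0_real.
rewrite ec ler0c in c0; rewrite ec -(rmorph1 (real_complex R)) lecR in c1.
exists c; split; first by rewrite c0.
  have /psdE/(_ (vtpow psi m)) := cp_positive cpO hk.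
  rewrite linear_mapB // OS Orho ec -expectE expectB !expectZ subr_ge0 => h.
  rewrite -lecR; have p0 : 0 <= p by case/andP: p01 => /ltW.
  apply: (@le_trans _ _ (p%:C * expect (vtpow psi m) tau)).
    by rewrite rmorphM /= ler_wpM2l ?ler0c.
  apply: (le_trans h); rewrite mulrA -rmorphM [X in _ <= X]rmorphM /=.
  by rewrite ler_wpM2l ?ler0c ?mulr_ge0 // mixed_stab_expect.
have := trOs (L%:C *: S - qtpow rho k).
have trX : \tr (L%:C *: S - qtpow rho k) = (L - 1)%:C.
  rewrite raddfB /= mxtraceZ (mixed_stab_tr hS) mulr1; case: hrho => _ ->.
  by rewrite rmorphB rmorph1.
have trOX : \tr (O (L%:C *: S - qtpow rho k)) = (L * c - p)%:C.
  rewrite linear_mapB // OS Orho ec raddfB /= !mxtraceZ (mixed_stab_tr hs').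
  by case: tauS => _ ->; rewrite !mulr1 rmorphB rmorphM.
rewrite raddfD /= trX trOX => e; rewrite -lecR -e lerDl raddf_sum /= big_seq.
apply: sumr_ge0 => O' /hOs[_ cpO' _ _].
exact/psd_tr/cp_positive.
Qed.

(** The infimum need not be known to be attained: exp(X / k) is a lower bound of all feasible [l],
    hence of their infimum. *)
Lemma rob_le_ln (X : R) :
  (forall (l : R) sigma, mixed_stab sigma -> loewner_le rho (l%:C *: sigma) ->
     X <= k%:R * ln l) ->
  X / ln (gen_rob rho) <= k%:R.
Proof.
move=> hX; rewrite /gen_rob; set E := [set _ | _]%classic.
have kR : (0 : R) < k%:R by rewrite ltr0n.
have [E0|E0] := pselect (exists l, E l); last first.
  (* Without feasible [l] the infimum is 0 by convention, its logarithm is 0, and so is the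
     quotient. *)
  have -> : E = set0 by apply/seteqP; split=> // l El; case: E0; exists l.
  by rewrite inf0 ln0 // invr0 mulr0 ler0n.
have inf_ge1 : 1 <= inf E by apply: lb_le_inf => // l [sigma [hs hl]]; exact: rob_ge1 hl.
have inf_ln : X / k%:R <= ln (inf E).
  rewrite -[X / _]expRK ler_ln ?posrE ?expR_gt0 // ?(lt_le_trans ltr01) //.
  apply: lb_le_inf => // l [sigma [hs hl]].
  have l0 : 0 < l by apply: lt_le_trans (rob_ge1 hs hl).
  rewrite -[l]lnK ?posrE // ler_expR ler_pdivrMr // mulrC.
  exact: hX hs hl.
(* At robustness 1 the denominator vanishes and the quotient is again 0. *)
have := ln_ge0 inf_ge1; rewrite le_eqVlt => /orP[/eqP <-|ln0].
  by rewrite invr0 mulr0 ler0n.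
by rewrite ler_pdivrMr // mulrC -ler_pdivrMr.
Qed.
End Bounds.

(** The tangent bound exp y >= 1 + y at y = (1 - p) x and y = - p x, averaged with weights p and 1 -
    p, gives 1; multiplication by exp(p x) finishes. *)
Lemma expR_convex0 (x p : R) : 0 <= p <= 1 -> expR (p * x) <= p * expR x + (1 - p).
Proof.
move=> /andP[p0 p1]; have q0 : 0 <= 1 - p by rewrite subr_ge0.
have h : 1 <= p * expR ((1 - p) * x) + (1 - p) * expR (- (p * x)).
  apply: le_trans (lerD (ler_wpM2l p0 (expR_ge1Dx _)) (ler_wpM2l q0 (expR_ge1Dx _))).
  by rewrite le_eqVlt; apply/orP; left; apply/eqP; ring.
have := ler_wpM2l (expR_ge0 (p * x)) h; rewrite mulr1 mulrDr !mulrA.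
rewrite [_ * p]mulrC [_ * (1 - p)]mulrC -!mulrA -!expRD subrr expR0 mulr1.
by rewrite -mulrDl [p + _]addrC subrK mul1r.
Qed.
End Distillation.

Theorem theorem7 (R : realType) (n q k m : nat)
  (rho : 'M[R[i]]_(2 ^ n)) (psi : 'cV[R[i]]_(2 ^ q)) (p eps : R)
  (O : 'M[R[i]]_(2 ^ (n * k)) -> 'M[R[i]]_(2 ^ (q * m)))
  (tau : 'M[R[i]]_(2 ^ (q * m))) :
  is_state rho ->
  (q <= 3)%N -> unit_vec psi ->
  (0 < k)%N -> (0 < m)%N ->
  0 < p <= 1 -> 0 <= eps < 1 ->
  prob_stab_op O ->
  is_state tau ->
  O (qtpow rho k) = p%:C *: tau ->
  (1 - eps)%:C <= expect (vtpow psi m) tau ->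
  ((ln p + ln (1 - eps) + m%:R * ln (stab_fid psi)^-1) / ln (gen_rob rho)
     <= k%:R)%R /\
  (p * ((ln (1 - eps) + m%:R * ln (stab_fid psi)^-1) / ln (gen_rob rho))
     <= k%:R)%R.
Proof.
move=> rhoS q3 upsi k0 m0 p01 /andP[_ eps1] hO tauS Orho tauF.
have F0 : 0 < stab_fid psi ^+ m by rewrite exprn_gt0 // stab_fid_gt0.
have e0 : 0 < 1 - eps by rewrite subr_gt0.
have /andP[p0 p1] := p01.
set Y := ln (1 - eps) + _.
have eY : expR Y = (1 - eps) / stab_fid psi ^+ m.
  have Fi : 0 < (stab_fid psi)^-1 by rewrite invr_gt0 stab_fid_gt0.
  rewrite /Y expRD expRM_natl !lnK ?posrE // exprVn.
  by [].
have L0 l sigma : mixed_stab sigma -> loewner_le rho (l%:C *: sigma) -> 0 < l ^+ k /\ 0 < l.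
  by move=> hs /(rob_ge1 rhoS hs) l1; rewrite exprn_gt0 (lt_le_trans ltr01).
have kln (X l : R) : 0 < l -> expR X <= l ^+ k -> X <= k%:R * ln l.
  move=> l0; rewrite mulr_natl -lnXn // => h.
  by rewrite -[X]expRK ler_ln ?posrE ?expR_gt0 ?exprn_gt0.
rewrite -addrA -/Y mulrA; apply: conj; apply: (rob_le_ln rhoS k0) => l sigma hs hl;
  have [Lk0 l0] := L0 _ _ hs hl; apply: kln => //;
  have [c [/andP[c0 c1] h1 h2]] :=
    rob_power_bounds rhoS q3 upsi k0 m0 p01 hO tauS Orho tauF hs hl.
(* For the first bound only c <= 1 is used. *)
- rewrite expRD lnK ?posrE // eY mulrA ler_pdivrMr //.
  apply: (le_trans h1); rewrite ler_pM2r // ler_piMr // ltW //.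
(* The chain is exp(p Y) <= p exp Y + 1 - p <= l^k c + 1 - p <= l^k, the last inequality being
   [h2]. *)
- apply: (le_trans (@expR_convex0 _ Y p _)); first by rewrite ltW.
  have h3 : p * expR Y <= l ^+ k * c by rewrite eY mulrA ler_pdivrMr.
  lra.
Qed.
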